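(* Let $\mathcal{F}:\mathcal{H}\to\mathcal{H}$ satisfy $\|\mathcal{F}(\mathbf{v})-\mathcal{F}(\mathbf{w})\|\le\rho\|\mathbf{v}-\mathbf{w}\|$ for all $\mathbf{v},\mathbf{w}\in\mathcal{H}$ with some $\rho\in(0,1)$, and let $\mathbf{u}^*$ be its unique fixed point. Let $\tilde\rho>\rho$, $c_0>0$, $\mathbf{u}_0:=0$, $\varepsilon_k:=\tilde\rho^k$, and consider the iteration $\mathbf{u}_{k+1}:=\mathbf{S}_{\alpha_k}(\mathcal{F}(\mathbf{u}_k))$, $k\ge0$. (i) If $\sigma_t(\mathbf{u}^* )\in\ell_{p,\infty}$, $t=1,\ldots,E$, for some $p\in(0,2)$, then for the choice $\alpha_k:=(\tilde\rho^{k+1}c_0)^{\frac{2}{2-p}}$ one has $$\|\mathbf{u}_k-\mathbf{u}^*\|\lesssim d\,\varepsilon_k,\qquad\max_{t=1,\ldots,E}\operatorname{rank}_t(\mathbf{u}_k)\lesssim d^2\varepsilon_k^{-1/s},\qquad s=\tfrac1p-\tfrac12.$$ (ii) If there are $C,c,\beta>0$ with $\sigma_{t,k}(\mathbf{u}^* )\le Ce^{-ck^\beta}$ for all $k\in\mathbb{N}$ and $t=1,\ldots,E$, then for the choice $\alpha_k:=\tilde\rho^{k+1}c_0$ one has $$\|\mathbf{u}_k-\mathbf{u}^*\|\lesssim d\,(1+|\log\varepsilon_k|)^{\frac1{2\beta}}\varepsilon_k,\qquad\max_{t=1,\ldots,E}\operatorname{rank}_t(\mathbf{u}_k)\lesssim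 d^2(1+|\log\varepsilon_k|)^{\frac1\beta}.$$
   Context: Tensor setting. $d\ge2$ and $\mathcal{H}=\mathcal{H}_1\otimes\cdots\otimes\mathcal{H}_d$ is a tensor product of separable (real) Hilbert spaces, with its canonical norm $\|\cdot\|$. $\mathbb{T}$ is a fixed binary dimension tree for $\{1,\ldots,d\}$: a collection of nonempty subsets of $\{1,\ldots,d\}$ containing the root $\{1,\ldots,d\}$, all of whose nodes with at least two elements are the disjoint union of exactly two children in $\mathbb{T}$, the leaves being the singletons. For $n\in\mathbb{T}$ put $[n]:=\{1,\ldots,d\}\setminus n$. The set of edges is $\mathbb{E}:=\{\{n,[n]\}: n\in\mathbb{T}\setminus\{\{1,\ldots,d\}\}\}$; it has $E:=2d-3$ elements, with a fixed enumeration $\{n_t,[n_t]\}$, $t=1,\ldots,E$. For $\mathbf{u}\in\mathcal{H}$, $\mathcal{M}_t(\mathbf{u}):\bigotimes_{i\in[n_t]}\mathcal{H}_i\to\bigotimes_{i\in n_t}\mathcal{H}_i$ is the Hilbert-Schmidt operator corresponding to $\mathbf{u}$ (matricization); $\mathcal{M}_t$ is a linear isometry onto the Hilbert-Schmidt operators, $\|\mathbf{u}\|=\|\mathcal{M}_t(\mathbf{u})\|_{\mathrm{HS}}$. $\sigma_t(\mathbf{u})=(\sigma_{t,k}(\mathbf{u}))_{k\in\mathbb{N}}$ is the non-increasing sequence of singular values of $\mathcal{M}_t(\mathbf{u})$ (extended by zero), and $\operatorname{rank}_t(\mathbf{u}):=\#\{k:\sigma_{t,k}(\mathbf{u})\ne0\}$.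 Soft thresholding. For $\alpha>0$, $s_\alpha(x):=\operatorname{sgn}(x)\max\{|x|-\alpha,0\}$ for $x\in\mathbb{R}$. For a Hilbert-Schmidt operator $X$ with singular value decomposition $X=\sum_i\sigma_i\langle\cdot,v_i\rangle u_i$, $S_\alpha(X):=\sum_i s_\alpha(\sigma_i)\langle\cdot,v_i\rangle u_i$. Set $S_{t,\alpha}:=\mathcal{M}_t^{-1}\circ S_\alpha\circ\mathcal{M}_t$ and $\mathbf{S}_\alpha:=S_{E,\alpha}\circ\cdots\circ S_{1,\alpha}:\mathcal{H}\to\mathcal{H}$. Weak-$\ell_p$. For a sequence $a$, with $a_n^*$ the $n$-th largest of the $|a_k|$, $|a|_{\ell_{p,\infty}}:=\sup_n n^{1/p}a_n^*$, and $\ell_{p,\infty}$ is the set of $a$ for which this is finite. $A\lesssim B$ means that there is a constant $C'>0$ with $A\le C'B$; here the constants do not depend on $k$ or $t$. *)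

(* Defs.v *)
From HB Require Import structures.
From mathcomp Require Import all_boot all_order all_algebra.
From mathcomp Require Import all_classical all_reals all_analysis.

Set Implicit Arguments.
Unset Strict Implicit.
Unset Printing Implicit Defensive.

Import Order.TTheory GRing.Theory Num.Theory.
Import numFieldNormedType.Exports.

Local Open Scope classical_set_scope.
Local Open Scope ring_scope.

Record hilbert (R : realType) := Hilbert {
  hilbert_sort :> completeNormedModType R;
  inner : hilbert_sort -> hilbert_sort -> R;
  innerC : forall x y, inner x y = inner y x;
  innerDl : forall x y z, inner (x + y) z = inner x z + inner y z;
  innerZl : forall (a : R) x y, inner (a *: x) y = a * inner x y;
  inner_norm : forall x, inner x x = `|x| ^+ 2
}.

Definition separable (T : topologicalType) : Prop :=
  exists2 D : set T, countable D & dense D.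

Section HilbertSpaces.
Context {R : realType}.
Implicit Types K L : hilbert R.

Definition lin_span K (B : set K) : set K :=
  [set x | exists n (c : 'I_n -> R) (e : 'I_n -> K),
     (forall j, B (e j)) /\ x = \sum_(j < n) c j *: e j].

Definition orthonormal_basis K (B : set K) : Prop :=
  (forall e f, B e -> B f -> inner e f = (e == f)%:R) /\ dense (lin_span B).

Definition hilbert_schmidt K L (X : K -> L) : Prop :=
  [/\ linear X, continuous X &
      forall B, orthonormal_basis B ->
        (\esum_(e in B) (`|X e| ^+ 2)%:E < +oo)%E].

(* X = \sum_i sigma_i <., v_i> u_i with sigma non-increasing. The sequence sigma
   is extended by zero, so v and u need only be orthonormal on its support;
   the spaces may be finite dimensional. *)
Definition is_svd K L (X : K -> L) (svd : (nat -> R) * (nat -> K) * (nat -> L))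
    : Prop :=
  let: (sigma, v, u) := svd in
  [/\ (forall i, 0 <= sigma i) /\ (forall i j, (i <= j)%N -> sigma j <= sigma i),
      forall i j, sigma i != 0 -> sigma j != 0 -> inner (v i) (v j) = (i == j)%:R,
      forall i j, sigma i != 0 -> sigma j != 0 -> inner (u i) (u j) = (i == j)%:R &
      forall w, series (fun i => (sigma i * inner w (v i)) *: u i) @ \oo --> X w].

(* Some singular value decomposition; one exists if X is Hilbert-Schmidt, and
   [singular_values] and [soft_thr_op] do not depend on the choice. *)
Definition svd K L (X : K -> L) : (nat -> R) * (nat -> K) * (nat -> L) :=
  xget point [set s | is_svd X s].

Definition singular_values K L (X : K -> L) : nat -> R := (svd X).1.1.

Definition soft_thr (alpha x : R) : R :=
  Num.sg x * Num.max (`|x| - alpha) 0.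

Definition soft_thr_op K L (alpha : R) (X : K -> L) : K -> L :=
  let: (sigma, v, u) := svd X in
  fun w => lim (series (fun i =>
    (soft_thr alpha (sigma i) * inner w (v i)) *: u i) @ \oo).

End HilbertSpaces.

Section WeakLp.
Context {R : realType}.
Implicit Types (a : nat -> R) (p : R).
Local Open Scope ereal_scope.

(* The (n+1)-th largest of the |a_k|: the least l >= 0 such that at most n
   indices k satisfy l < |a_k|. *)
Definition rearrangement a (n : nat) : \bar R :=
  ereal_inf [set l%:E | l in
    [set l : R | (0 <= l)%R /\ counting [set k | (l < `|a k|)%R] <= n%:R%:E :> \bar R]].

Definition weak_lp_norm p a : \bar R :=
  ereal_sup (range (fun n : nat => (n.+1%:R `^ p^-1)%:E * rearrangement a n)).

Definition weak_lp p : set (nat -> R) := [set a | weak_lp_norm p a < +oo].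

End WeakLp.

Section DimensionTrees.
Context {d : nat}.
Local Open Scope set_scope.
Implicit Types (T : {set {set 'I_d}}) (n : {set 'I_d}).

Definition tree_children T n : {set {set 'I_d}} :=
  [set m | maxset (fun m' => (m' \in T) && (m' \proper n)) m].

(* The leaves are then the singletons: a node with at least two elements has
   children, and a proper subset of a singleton is empty. *)
Definition dimension_tree T : Prop :=
  [/\ finset.set0 \notin T, [set: 'I_d] \in T &
      forall n, n \in T -> (2 <= #|n|)%N ->
        #|tree_children T n| = 2%N /\ finset.partition (tree_children T n) n].

Definition edge n : {set {set 'I_d}} := [set n; ~: n].

Definition tree_edges T : {set {set {set 'I_d}}} :=
  [set edge n | n in T :\ [set: 'I_d]].

Definition edge_enumeration T (E : nat) (n_ : 'I_E -> {set 'I_d}) : Prop :=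
  [/\ forall t, n_ t \in T :\ [set: 'I_d],
      injective (fun t => edge (n_ t)) &
      [set edge (n_ t) | t in 'I_E] = tree_edges T].

End DimensionTrees.

(* The Hilbert tensor products of the H_i, i in A, for all A. They are determined
   up to isometric isomorphism by the inner products of elementary tensors and the
   density of their span. [pure A x] is the tensor product of the x_i, i in A: the
   inner product formula makes it multilinear in these x_i and independent of the
   others, so that it can be applied to a family x indexed by all of 'I_d. *)
Record tensor_space (R : realType) (d : nat) (H : 'I_d -> hilbert R) :=
  TensorSpace {
    tspace :> {set 'I_d} -> hilbert R;
    pure : forall A : {set 'I_d}, (forall i, H i) -> tspace A;
    inner_pure : forall A x y,
      inner (pure A x) (pure A y) = \prod_(i in A) inner (x i) (y i);
    dense_pure : forall A, dense (lin_span (range (pure A)))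
  }.

Section HierarchicalTensors.
Context {R : realType} {d : nat} {H : 'I_d -> hilbert R}.
Variable V : tensor_space H.
Local Notation full := [set: 'I_d]%SET.
Local Notation co A := (~: A)%SET.

(* The Hilbert-Schmidt operator X corresponding to u satisfies
   <X y, x> = <u, x (x) y> for x in V A and y in V (~: A). By linearity and density
   this is the requirement on elementary tensors below, where one family z
   provides the coordinates of x in A and those of y outside A. It determines X. *)
Definition is_matricization (A : {set 'I_d}) (u : V full)
    (X : V (co A) -> V A) : Prop :=
  hilbert_schmidt X /\
  forall z, inner (X (pure V (co A) z)) (pure V A z) = inner u (pure V full z).

Arguments is_matricization : clear implicits.

Definition matricization (A : {set 'I_d}) (u : V full) : V (co A) -> V A :=
  xget point [set X | is_matricization A u X].

Arguments matricization : clear implicits.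

Definition matricization_inv (A : {set 'I_d}) (X : V (co A) -> V A) : V full :=
  xget 0 [set u | matricization A u = X].

Definition tensor_sv (A : {set 'I_d}) (u : V full) : nat -> R :=
  singular_values (matricization A u).

Definition tensor_rank (A : {set 'I_d}) (u : V full) : \bar R :=
  counting [set k | tensor_sv A u k != 0].

Definition soft_thr_at (A : {set 'I_d}) (alpha : R) (u : V full) : V full :=
  matricization_inv (soft_thr_op alpha (matricization A u)).

Variables (E : nat) (n_ : 'I_E -> {set 'I_d}).

(* [enum 'I_E] is increasing, so the first edge is thresholded first. *)
Definition soft_thr_all (alpha : R) (u : V full) : V full :=
  foldl (fun v t => soft_thr_at (n_ t) alpha v) u (enum 'I_E).

Fixpoint stii (F : V full -> V full) (alpha_ : nat -> R) (k : nat) : V full :=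
  if k is k'.+1 then soft_thr_all (alpha_ k') (F (stii F alpha_ k')) else 0.

End HierarchicalTensors.

(* Main.v *)
Require Import Defs.
From HB Require Import structures.
From mathcomp Require Import all_boot all_order all_algebra.
From mathcomp Require Import all_classical all_reals all_analysis.
From mathcomp Require Import finmap ring lra.
Set Implicit Arguments.
Unset Strict Implicit.
Unset Printing Implicit Defensive.
Import Order.TTheory GRing.Theory Num.Theory.
Import numFieldNormedType.Exports.
Local Open Scope classical_set_scope.
Local Open Scope ring_scope.

(** S_{t,al} is the proximal map of al times the nuclear norm: the residual
    u - S_{t,al} u has operator norm at most al and pairs with S_{t,al} u as al
    times its nuclear norm. Hence S_{t,al} is firmly nonexpansive, and
    |u_{k+1} - ustar| <= rho |u_k - ustar| + sum_t |S_{t,al_k} ustar - ustar|, where each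
    |S_{t,al} ustar - ustar|^2 = sum_k min(sigma_k, al)^2 is estimated by splitting the
    levels al, al / 2, al / 4, and so on, from a bound on the number of singular
    values above a level. The rank after thresholding v at edge t is the number of
    sigma_{t,k}(v) above al, at most 2 #{sigma_{t,k}(ustar) > al / 2} plus
    4 |v - ustar|^2 / al^2; later thresholdings do not increase it, because nodes of
    the tree are nested or disjoint, so that they act on one side of M_t only.

    The singular value decomposition is obtained in its Schmidt form in the tensor
    product: a best rank-one approximation exists by weak compactness, and greedy
    deflation by such approximations converges. *)

(** * Real Hilbert spaces *)

(** The choice of [alpha_k] is a balance. If [phi] bounds the number of singular values of [ustar]
    above a level, the squared thresholding error at an edge is at most al^2 Psi(al), where Psi(al)
    is a multiple of al^-p in part (i) and of a power of a logarithm in part (ii). The level makes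
    this error of order rhot^(k+1), up to the logarithm; as rho < rhot, the recursion keeps the rate
    rhot^k at the price of a factor 1 / (rhot - rho). The rank bound contains the squared ratio of
    error and level, and the error a factor d from the 2d - 3 edges, whence d^2. The obstacle is
    that edges are thresholded in succession: the tensor that reaches edge t is no longer F(u_k),
    and nothing is known about its singular values. So every estimate compares with [ustar] by
    nonexpansiveness, and only counts for [ustar] enter. Uniform constants require a bound on the
    norm of [ustar] by [phi] alone: at a level where [phi] is below 1, thresholding sends [ustar] to
    0, so its norm is itself a thresholding error. *)

Lemma ler_cvg_filter (R : realType) (T : Type) (F : set_system T)
    (FF : ProperFilter F) (f g : T -> R) (l l' : R) :
  f @ F --> l -> g @ F --> l' -> (forall t, f t <= g t) -> l <= l'.
Proof.
move=> fl gl fg; rewrite -subr_ge0.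
apply: (cvgr_to_ge (cvgB gl fl)).
by apply: nearW => t; rewrite subr_ge0.
Qed.

Section InnerProduct.
Context {R : realType} {K : hilbert R}.
Implicit Types x y z : K.

Lemma innerDr x y z : inner x (y + z) = inner x y + inner x z.
Proof. by rewrite innerC innerDl !(innerC x). Qed.

Lemma innerZr (a : R) x y : inner x (a *: y) = a * inner x y.
Proof. by rewrite innerC innerZl innerC. Qed.

Lemma inner0l x : inner 0 x = 0.
Proof. by rewrite -(scale0r 0) innerZl mul0r. Qed.

Lemma inner0r x : inner x 0 = 0.
Proof. by rewrite innerC inner0l. Qed.

Lemma innerNl x y : inner (- x) y = - inner x y.
Proof. by rewrite -scaleN1r innerZl mulN1r. Qed.

Lemma innerNr x y : inner x (- y) = - inner x y.
Proof. by rewrite innerC innerNl innerC. Qed.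

Lemma innerBl x y z : inner (x - y) z = inner x z - inner y z.
Proof. by rewrite innerDl innerNl. Qed.

Lemma innerBr x y z : inner x (y - z) = inner x y - inner x z.
Proof. by rewrite innerDr innerNr. Qed.

Lemma inner_suml (I : Type) (r : seq I) (P : pred I) (f : I -> K) x :
  inner (\sum_(i <- r | P i) f i) x = \sum_(i <- r | P i) inner (f i) x.
Proof.
elim/big_rec2: _ => [|i a b _ <-]; first by rewrite inner0l.
by rewrite innerDl.
Qed.

Lemma inner_sumr (I : Type) (r : seq I) (P : pred I) (f : I -> K) x :
  inner x (\sum_(i <- r | P i) f i) = \sum_(i <- r | P i) inner x (f i).
Proof. by rewrite innerC inner_suml; apply: eq_bigr => i _; rewrite innerC. Qed.

Lemma inner_ge0 x : 0 <= inner x x.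
Proof. by rewrite inner_norm sqr_ge0. Qed.

Lemma inner_eq0 x : inner x x = 0 -> x = 0.
Proof. by rewrite inner_norm => /eqP; rewrite sqrf_eq0 normr_eq0 => /eqP. Qed.

Lemma norm_sqrD x y : `|x + y| ^+ 2 = `|x| ^+ 2 + 2 * inner x y + `|y| ^+ 2.
Proof.
by rewrite -!inner_norm innerDl !innerDr (innerC y x); ring.
Qed.

Lemma norm_sqrB x y : `|x - y| ^+ 2 = `|x| ^+ 2 - 2 * inner x y + `|y| ^+ 2.
Proof. by rewrite norm_sqrD innerNr normrN; ring. Qed.

Lemma cauchy_schwarz x y : `|inner x y| <= `|x| * `|y|.
Proof.
have [->|y0] := eqVneq y 0; first by rewrite inner0r !normr0 mulr0.
have yn : 0 < `|y| by rewrite normr_gt0.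
rewrite -ler_sqr ?nnegrE ?mulr_ge0 // real_normK ?num_real // exprMn.
have := sqr_ge0 `| `|y| ^+ 2 *: x - inner x y *: y|.
rewrite norm_sqrB !normrZ innerZl innerZr !exprMn !real_normK ?num_real //.
set a := inner x y => H.
have : 0 <= `|y| ^+ 2 * (`|x| ^+ 2 * `|y| ^+ 2 - a ^+ 2) by nra.
by rewrite pmulr_rge0 ?exprn_gt0 // subr_ge0.
Qed.

Lemma inner_le x y : inner x y <= `|x| * `|y|.
Proof. exact: le_trans (ler_norm _) (cauchy_schwarz x y). Qed.

(* The predicate selects the indices with nonzero coefficient; the remaining
   vectors of a singular value decomposition are arbitrary. *)
Definition ortho_on (I : eqType) (P : pred I) (e : I -> K) :=
  forall i j, P i -> P j -> inner (e i) (e j) = (i == j)%:R.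

Lemma norm_ortho_sum (I : eqType) (s : seq I) (P : pred I) (e : I -> K)
    (c : I -> R) : uniq s -> ortho_on P e ->
  `|\sum_(i <- s | P i) c i *: e i| ^+ 2 = \sum_(i <- s | P i) c i ^+ 2.
Proof.
move=> us oe; elim: s us => [|j s IH] /=; first by rewrite !big_nil normr0 expr0n.
move=> /andP[js us]; rewrite !big_cons; case: ifPn => [Pj|_]; last exact: IH.
rewrite norm_sqrD IH // normrZ exprMn real_normK ?num_real //.
rewrite -inner_norm oe // eqxx mulr1 inner_sumr.
rewrite [X in _ + 2 * X]big_seq_cond big1 ?mulr0 ?addr0 // => i /andP[si Pi].
rewrite innerZl innerZr oe //.
by case: eqVneq => [ji|_]; rewrite ?mulr0 //; move: js; rewrite ji si.
Qed.

Lemma bessel (I : eqType) (s : seq I) (P : pred I) (e : I -> K) x :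
  uniq s -> ortho_on P e ->
  \sum_(i <- s | P i) inner x (e i) ^+ 2 <= `|x| ^+ 2.
Proof.
move=> us oe; set S := \sum_(i <- s | P i) _.
have := sqr_ge0 `|x - \sum_(i <- s | P i) inner x (e i) *: e i|.
rewrite norm_sqrB norm_ortho_sum // inner_sumr -/S.
rewrite (_ : \sum_(i <- s | P i) _ = S); last first.
  by apply: eq_bigr => i _; rewrite innerZr.
lra.
Qed.

Lemma inner_continuousl y : continuous (fun x => inner x y).
Proof.
move=> x; apply/cvgrPdist_lt => e e0.
have y1 : 0 < `|y| + 1 by rewrite ltr_pwDr.
near=> z; rewrite -innerBl (le_lt_trans (cauchy_schwarz _ _)) //.
apply: (@le_lt_trans _ _ (`|x - z| * (`|y| + 1))); first by rewrite ler_wpM2l ?lerDl.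
rewrite -ltr_pdivlMr //; near: z.
apply: cvgr_dist_lt; [exact: cvg_id | by rewrite divr_gt0].
Unshelve. all: by end_near. Qed.

Lemma cvg_inner (T : Type) (F : set_system T) {FF : Filter F} (f : T -> K) x y :
  f @ F --> x -> (fun t => inner (f t) y) @ F --> inner x y.
Proof.
move=> fx.
exact: (@continuous_cvg _ _ _ F FF f (fun z => inner z y) x (@inner_continuousl y x) fx).
Qed.

Lemma bounded_additive_continuous (L : normedModType R) (f : K -> L) (C : R) :
  (forall x y, f (x - y) = f x - f y) -> (forall x, `|f x| <= C * `|x|) ->
  continuous f.
Proof.
move=> fB fC x; apply/cvgrPdist_lt => e e0.
have C1 : 0 < `|C| + 1 by rewrite ltr_pwDr.
near=> z; rewrite -fB (le_lt_trans (fC _)) //.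
apply: (@le_lt_trans _ _ ((`|C| + 1) * `|x - z|)).
  by rewrite ler_wpM2r // (le_trans (ler_norm _)) // lerDl.
rewrite -ltr_pdivlMl // mulrC; near: z.
apply: cvgr_dist_lt; [exact: cvg_id | by rewrite divr_gt0].
Unshelve. all: by end_near. Qed.

Lemma dense_approx (S : set K) x (e : R) : dense S -> 0 < e ->
  exists2 y, S y & `|x - y| < e.
Proof.
move=> dS e0.
have [|y [By Sy]] := dS (ball x e) _ (ball_open x e).
  by exists x; exact: ballxx.
by exists y => //; move: By; rewrite -ball_normE.
Qed.

Lemma dense_continuous0 (S : set K) (h : K -> R) : dense S -> continuous h ->
  (forall x, S x -> h x = 0) -> forall x, h x = 0.
Proof.
move=> dS ch hS x; apply/eqP; apply: contrapT => /negP hx.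
have oO : open [set y | h y != 0].
  have -> : [set y | h y != 0] = h @^-1` (~` [set 0]).
    by apply/seteqP; split => y /= /eqP.
  apply: open_comp; first by move=> ? _; exact: ch.
  by apply: closed_openC; exact: closed_eq.
by have [|y [/eqP + /hS]] := dS _ _ oO; [exists x|].
Qed.

Lemma eq_inner (I : Type) (p : I -> K) x y :
  dense (lin_span (range p)) -> (forall i, inner x (p i) = inner y (p i)) ->
  x = y.
Proof.
move=> dp xy; apply/eqP; rewrite -subr_eq0; apply/eqP/inner_eq0.
apply: (@dense_continuous0 _ (fun z => inner z (x - y)) dp).
  exact: inner_continuousl.
move=> z [n [c [e [pe ->]]]]; rewrite inner_suml big1 // => j _.
by have [i _ <-] := pe j; rewrite innerZl innerC innerBl xy subrr mulr0.
Qed.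

(** Expanding |q|^2 = <q - x, q> + <x, q> gives |q| (|q| - C) <= |q - x| (|q| + C), so an x in S
    close enough to q excludes |q| > C. *)
Lemma dense_inner_bound (S : set K) q (C : R) : dense S -> 0 <= C ->
  (forall x, S x -> inner x q <= C * `|x|) -> `|q| <= C.
Proof.
move=> dS C0 H; case: (lerP `|q| C) => // Cq; exfalso.
have q0 : 0 < `|q| by exact: le_lt_trans Cq.
have D0 : 0 < `|q| * (`|q| - C) by rewrite mulr_gt0 // subr_gt0.
have E0 : 0 < `|q| + C by rewrite ltr_wpDr.
have [x Sx qx] := dense_approx q dS (divr_gt0 D0 E0).
move: qx; rewrite ltr_pdivlMr // => qx.
have xle : `|x| <= `|q| + `|q - x|.
  by rewrite -{1}(subKr q x) (le_trans (ler_normB _ _)).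
have := inner_norm q; rewrite -{1}(subrK x q) innerDl => Hq.
have := inner_le (q - x) q; have := H _ Sx => H1 H2.
have : C * `|x| <= C * (`|q| + `|q - x|) by rewrite ler_wpM2l.
nra.
Qed.

End InnerProduct.

(** * Completeness and representation of bounded functionals *)

Section Completeness.
Context {R : realType} {K : hilbert R}.

Lemma cauchy_modulus_cvg (v : nat -> K) (g : nat -> R) :
  (forall n m, (n <= m)%N -> `|v m - v n| ^+ 2 <= g n) ->
  g @ \oo --> (0 : R) -> exists l : K, v @ \oo --> l.
Proof.
move=> vg g0; suff: cvg (v @ \oo) by move=> ?; exists (lim (v @ \oo)).
apply/cauchy_cvgP/cauchy_exP => e e0.
have e20 : 0 < e ^+ 2 by rewrite exprn_gt0.
have [N _ HN] := (@cvgr0_norm_lt _ _ _ _ _ _ g0) _ e20.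
exists (v N); exists N => // m /= Nm.
rewrite -ball_normE /= -ltr_sqr ?nnegrE ?(ltW e0) // distrC.
rewrite (le_lt_trans (vg _ _ Nm)) // (le_lt_trans (ler_norm _)) //.
by apply: HN => /=.
Qed.

(* The representing vector minimises |v|^2 - 2 t over the graph D of the
   functional; parallelogram identity gives convergence of minimising sequences. *)
Lemma riesz_graph (D : K -> R -> Prop) (M : R) :
  D 0 0 -> 0 <= M ->
  (forall a v t w s, D v t -> D w s -> D (a *: v + w) (a * t + s)) ->
  (forall v t, D v t -> t <= M * `|v|) ->
  exists2 x, `|x| <= M & forall v t, D v t -> inner x v = t.
Proof.
move=> D0 M0 Dlin DM.
pose J (p : K * R) := `|p.1| ^+ 2 - 2 * p.2.
pose E := [set J p | p in [set p | D p.1 p.2]].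
have E0 : E !=set0 by exists (J (0, 0)), (0, 0).
have lbE : lbound E (- M ^+ 2).
  move=> _ [[v t] /= Dvt <-]; rewrite /J /=.
  by have := DM _ _ Dvt; have := sqr_ge0 (`|v| - M); nra.
have hiE : has_inf E by split=> //; exists (- M ^+ 2).
set j := inf E.
have jle v t : D v t -> j <= `|v| ^+ 2 - 2 * t.
  by move=> Dvt; apply: ge_inf; [exists (- M ^+ 2)|exists (v, t)].
have /choice[s Hs] n : exists p : K * R, D p.1 p.2 /\ J p < j + n.+1%:R^-1.
  have n0 : 0 < n.+1%:R^-1 :> R by rewrite invr_gt0.
  by have [_ [p Dp <-] Hp] := inf_adherent n0 hiE; exists p.
have inv0 : (fun n => n.+1%:R^-1) @ \oo --> (0 : R) by exact: cvg_harmonic.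
have [| |x sx] := @cauchy_modulus_cvg (fun n => (s n).1) (fun n => 4 * n.+1%:R^-1).
- move=> n m nm; have [Dn Jn] := Hs n; have [Dm Jm] := Hs m.
  have nmi : m.+1%:R^-1 <= n.+1%:R^-1 :> R by rewrite lef_pV2 ?posrE // ler_nat.
  have Dh : D (2^-1 *: ((s n).1 + (s m).1)) (2^-1 * ((s n).2 + (s m).2)).
    rewrite -[_ *: _]addr0 -[_ * _]addr0; apply: (Dlin) => //.
    by rewrite -[(s n).1]scale1r -[(s n).2]mul1r; apply: Dlin.
  move: Jn Jm (jle _ _ Dh); rewrite /J /= normrZ exprMn norm_sqrB norm_sqrD.
  rewrite ger0_norm ?invr_ge0 // (innerC (s m).1).
  have -> : 2^-1 ^+ 2 = 4^-1 :> R by rewrite exprVn -natrX.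
  move: nmi; set a := inner _ _; set b := n.+1%:R^-1; set c := m.+1%:R^-1.
  lra.
- by rewrite -[X in _ --> X](mulr0 4); apply: cvgMr.
have Dx v t : D v t -> inner x v = t.
  move=> Dvt.
  (* The minimising sequence shifted by c v stays in D; comparing the values of J and passing to the
     limit leaves a nonnegative quadratic in c. *)
  have key c : 0 <= 2 * c * (inner x v - t) + c ^+ 2 * `|v| ^+ 2.
    apply: (@ler_cvg_filter R nat \oo _ (fun n => - n.+1%:R^-1)
      (fun n => 2 * c * (inner (s n).1 v - t) + c ^+ 2 * `|v| ^+ 2)).
    - by rewrite -oppr0; apply: cvgN.
    - apply: cvgD; last exact: cvg_cst.
      apply: cvgMr; apply: cvgB; last exact: cvg_cst.
      exact: cvg_inner.
    - move=> n; have [Dn Jn] := Hs n.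
      have := jle _ _ (Dlin c _ _ _ _ Dvt Dn); move: Jn; rewrite /J /=.
      rewrite norm_sqrD normrZ exprMn real_normK ?num_real // innerZl.
      rewrite (innerC v); set b := n.+1%:R^-1; lra.
  set h := inner x v - t in key; apply/eqP; rewrite -subr_eq0 -/h.
  have V1 : 0 < `|v| ^+ 2 + 1 by rewrite ltr_wpDl ?sqr_ge0.
  (* This c makes the quadratic negative unless h = 0; the added 1 covers v = 0. *)
  have := key (- h / (`|v| ^+ 2 + 1)).
  rewrite (_ : _ + _ = - (h ^+ 2 * (`|v| ^+ 2 + 2)) / (`|v| ^+ 2 + 1) ^+ 2); last first.
    by field; rewrite gt_eqF.
  rewrite pmulr_lge0 ?invr_gt0 ?exprn_gt0 // oppr_ge0 => H.
  have : h ^+ 2 <= 0 by have := sqr_ge0 h; have := sqr_ge0 `|v|; nra.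
  by rewrite -sqrf_eq0 eq_le sqr_ge0 => ->.
exists x => //.
have : `|x| ^+ 2 <= M * `|x|.
  apply: (@ler_cvg_filter R nat \oo _ (fun n => inner (s n).1 x)
    (fun n => M * `|(s n).1|)).
  - by rewrite -inner_norm; exact: cvg_inner.
  - by apply: cvgMr; exact: cvg_norm.
  - by move=> n; have [Dn _] := Hs n; rewrite innerC (Dx _ _ Dn); exact: DM.
have [->|x0] := eqVneq x 0; first by rewrite normr0.
by rewrite expr2 ler_pM2r // normr_gt0.
Qed.

End Completeness.

(** * Weak limits of bounded sequences along ultrafilters *)

Section WeakLimits.
Context {R : realType}.

(** Compactness of the segment gives a cluster point, and an ultrafilter converges to each of its
    cluster points. *)
Lemma ultra_bounded_cvg (U : set_system nat) (FU : UltraFilter U)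
    (f : nat -> R) (M : R) : (forall n, `|f n| <= M) ->
  exists l : R, f @ U --> l.
Proof.
move=> fM.
have /(_ (f @ U)) : compact `[- M, M] by exact: segment_compact.
case.
  by apply: (@filterS _ U _ setT) => [n _|]; [rewrite /= in_itv /= -ler_norml | exact: filterT].
move=> l [_ cl]; exists l => A Al.
have [//|UnA] := in_ultra_setVsetC (f @^-1` A) FU.
by have [x [? ?]] := cl (~` A) A UnA Al.
Qed.

Context {K : hilbert R}.

Lemma riesz (l : K -> R) (M : R) : 0 <= M ->
  (forall a x y, l (a *: x + y) = a * l x + l y) ->
  (forall x, l x <= M * `|x|) ->
  exists2 x, `|x| <= M & forall y, inner x y = l y.
Proof.
move=> M0 ll lM.
have l0 : l 0 = 0 by have := ll 1 0 0; rewrite scale1r mul1r addr0; lra.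
have [|a v t w s <- <-|v t <-|x xM Hx] := @riesz_graph R K (fun v t => l v = t) M _ M0.
- by [].
- exact: ll.
- exact: lM.
- by exists x => // y; exact: Hx.
Qed.

(** One ultrafilter gives limits for all x at once, in place of a diagonal extraction; the limit
    functional is bounded by 1, hence represented by some [b0]. *)
Lemma weak_limit (U : set_system nat) (FU : UltraFilter U) (b : nat -> K) :
  (forall n, `|b n| <= 1) ->
  exists2 b0, `|b0| <= 1 & forall x, (fun n => inner (b n) x) @ U --> inner b0 x.
Proof.
move=> b1.
have bx x n : `|inner (b n) x| <= `|x|.
  by rewrite (le_trans (cauchy_schwarz _ _)) // ler_piMl.
have /choice[l Hl] x : exists l : R, (fun n => inner (b n) x) @ U --> l.
  exact: ultra_bounded_cvg (bx x).
have [||b0 b01 Hb0] := @riesz l 1 ler01.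
- move=> a x y.
  have : (fun n => inner (b n) (a *: x + y)) @ U --> a * l x + l y.
    under eq_fun do rewrite innerDr innerZr.
    by apply: cvgD; [apply: cvgM; [exact: cvg_cst|exact: Hl]|exact: Hl].
  by move=> H; apply: (cvg_unique _ (Hl _) H).
- move=> x; apply: (ler_cvg_filter _ (Hl x) (cvg_cst (1 * `|x|))) => n.
  by rewrite mul1r (le_trans (ler_norm _)).
- by exists b0 => // x; rewrite Hb0; exact: Hl.
Qed.

End WeakLimits.

(** * Tensor product of two Hilbert spaces and Schmidt decomposition *)

(** W is the Hilbert tensor product of L and K. Bilinearity of T follows: by the inner product
    formula, the difference of the two sides of each identity has norm zero. *)
Definition tensor_map (R : realType) (L K W : hilbert R) (T : L -> K -> W) :=
  (forall a b a' b', inner (T a b) (T a' b') = inner a a' * inner b b') /\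
  dense (lin_span (range (fun p => T p.1 p.2))).

Section TensorMap.
Context {R : realType} {L K W : hilbert R} {T : L -> K -> W}.
Hypothesis tT : tensor_map T.

Let innerT a b a' b' : inner (T a b) (T a' b') = inner a a' * inner b b'.
Proof. exact: tT.1. Qed.

Lemma norm_tmap a b : `|T a b| = `|a| * `|b|.
Proof.
apply/eqP; rewrite -(@eqrXn2 _ 2) ?mulr_ge0 //; apply/eqP.
by rewrite exprMn -!inner_norm innerT.
Qed.

Lemma tmapDl a a' b : T (a + a') b = T a b + T a' b.
Proof.
apply/eqP; rewrite -subr_eq0; apply/eqP/inner_eq0.
by rewrite !(innerBl, innerBr, innerDl, innerDr, innerT); ring.
Qed.

Lemma tmapDr a b b' : T a (b + b') = T a b + T a b'.
Proof.
apply/eqP; rewrite -subr_eq0; apply/eqP/inner_eq0.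
by rewrite !(innerBl, innerBr, innerDl, innerDr, innerT); ring.
Qed.

Lemma tmapZl c a b : T (c *: a) b = c *: T a b.
Proof.
apply/eqP; rewrite -subr_eq0; apply/eqP/inner_eq0.
by rewrite !(innerBl, innerBr, innerZl, innerZr, innerT); ring.
Qed.

Lemma tmapZr c a b : T a (c *: b) = c *: T a b.
Proof.
apply/eqP; rewrite -subr_eq0; apply/eqP/inner_eq0.
by rewrite !(innerBl, innerBr, innerZl, innerZr, innerT); ring.
Qed.

Lemma tmap_suml (I : Type) (r : seq I) (P : pred I) (f : I -> L) b :
  T (\sum_(i <- r | P i) f i) b = \sum_(i <- r | P i) T (f i) b.
Proof.
elim/big_rec2: _ => [|i x y _ <-]; last by rewrite tmapDl.
by rewrite -(scale0r 0) tmapZl scale0r.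
Qed.

Lemma eq_tmap w w' : (forall a b, inner w (T a b) = inner w' (T a b)) -> w = w'.
Proof. by move=> H; apply: (eq_inner tT.2) => -[a b]. Qed.

Lemma tmap_flip : tensor_map (fun b a => T a b).
Proof.
split=> [a b a' b'|]; first by rewrite innerT mulrC.
have -> : range (fun p => T p.2 p.1) = range (fun p => T p.1 p.2).
  by apply/seteqP; split=> _ [[a b] _ <-]; exists (b, a).
exact: tT.2.
Qed.

Lemma slice_ex w b : exists2 a0, `|a0| <= `|w| * `|b| &
  forall a, inner a0 a = inner w (T a b).
Proof.
apply: (riesz (l := fun a => inner w (T a b))); first by rewrite mulr_ge0.
  by move=> c x y; rewrite tmapDl tmapZl innerDr innerZr.
by move=> x; rewrite (le_trans (inner_le _ _)) // norm_tmap mulrA mulrAC.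
Qed.

(** The contraction of w with b in the second factor; as a function of b it is the Hilbert-Schmidt
    operator corresponding to w. *)
Definition slice w b : L := projT1 (cid2 (slice_ex w b)).

Lemma norm_slice w b : `|slice w b| <= `|w| * `|b|.
Proof. by rewrite /slice; case: cid2. Qed.

Lemma sliceE w b a : inner (slice w b) a = inner w (T a b).
Proof. by rewrite /slice; case: cid2. Qed.

Lemma inner_ext (H : hilbert R) (x y : H) :
  (forall z, inner x z = inner y z) -> x = y.
Proof.
move=> xy; apply/eqP; rewrite -subr_eq0; apply/eqP/inner_eq0.
by rewrite innerBl xy subrr.
Qed.

Lemma slice_linear w : linear (slice w).
Proof.
move=> c x y; apply: inner_ext => z.
by rewrite innerDl innerZl !sliceE tmapDr tmapZr innerDr innerZr.
Qed.

Lemma sliceBr w x y : slice w (x - y) = slice w x - slice w y.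
Proof.
by rewrite addrC -scaleN1r slice_linear scaleN1r addrC.
Qed.

Lemma sliceDl w w' b : slice (w + w') b = slice w b + slice w' b.
Proof. by apply: inner_ext => z; rewrite innerDl !sliceE innerDl. Qed.

Lemma sliceZl c w b : slice (c *: w) b = c *: slice w b.
Proof. by apply: inner_ext => z; rewrite innerZl !sliceE innerZl. Qed.

Lemma sliceBl w w' b : slice (w - w') b = slice w b - slice w' b.
Proof. by rewrite sliceDl -[- w']scaleN1r sliceZl scaleN1r. Qed.

Lemma slice_tmap a b b' : slice (T a b) b' = inner b b' *: a.
Proof. by apply: inner_ext => z; rewrite sliceE innerT innerZl mulrC. Qed.

Lemma slice_suml (I : Type) (r : seq I) (P : pred I) (f : I -> W) b :
  slice (\sum_(i <- r | P i) f i) b = \sum_(i <- r | P i) slice (f i) b.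
Proof.
elim/big_rec2: _ => [|i x y _ <-]; last by rewrite sliceDl.
by rewrite -(scale0r 0) sliceZl scale0r.
Qed.

Lemma slice_continuous w : continuous (slice w).
Proof.
by apply: (@bounded_additive_continuous _ _ _ _ `|w|); [exact: sliceBr|exact: norm_slice].
Qed.

Lemma cvg_slice (I : Type) (F : set_system I) {FF : Filter F} (f : I -> W) w b :
  f @ F --> w -> (fun i => slice (f i) b) @ F --> slice w b.
Proof.
move=> fw; apply: (@continuous_cvg _ _ _ F FF f (fun z => slice z b) w _ fw).
apply: (@bounded_additive_continuous _ _ _ _ `|b|).
  by move=> x y; exact: sliceBl.
by move=> x; rewrite mulrC norm_slice.
Qed.

(** For finitely many orthonormal e, the sum S of the |slice w e|^2 equals both |v|^2 and <w, v>,
    where v is the sum of the [T (slice w e) e]; Cauchy-Schwarz then gives S^2 <= |w|^2 S. *)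
Lemma slice_hilbert_schmidt w : hilbert_schmidt (slice w).
Proof.
split; [exact: slice_linear|exact: slice_continuous|] => B [oB _].
apply: (@le_lt_trans _ _ (`|w| ^+ 2)%:E); last exact: ltry.
apply: ge_ereal_sup => _ [F [finF FB] <-].
rewrite fsbig_finite //= sumEFin lee_fin.
set S := \sum_(e <- _) _; pose s := finmap.enum_fset (fset_set F).
have uF : {in s, forall e, B e} by move=> e es; apply: FB; have : e \in fset_set F by []; rewrite in_fset_set // => /set_mem.
pose v := \sum_(e <- s) T (slice w e) e.
have vS : `|v| ^+ 2 = S.
  rewrite -inner_norm inner_suml [RHS]big_seq [LHS]big_seq; apply: eq_bigr => e es.
  have Be := uF _ es; rewrite inner_sumr (bigD1_seq e) ?finmap.fset_uniq //= innerT oB // eqxx mulr1 inner_norm.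
  rewrite [X in _ + X]big_seq_cond big1 ?addr0 // => f /andP[fs fe].
  have Bf := uF _ fs; by rewrite innerT oB // eq_sym (negbTE fe) mulr0.
have wS : inner w v = S.
  by rewrite inner_sumr; apply: eq_bigr => e _; rewrite -sliceE inner_norm.
have : S ^+ 2 <= `|w| ^+ 2 * S.
  rewrite -{2}vS -exprMn -{1}wS -[leLHS]real_normK ?num_real //.
  by rewrite ler_sqr ?nnegrE ?mulr_ge0 // cauchy_schwarz.
have [->|S0] := eqVneq S 0; first by rewrite sqr_ge0.
have S1 : 0 < S by rewrite lt_neqAle eq_sym S0 -vS sqr_ge0.
by rewrite expr2 ler_pM2r.
Qed.

(* Weak compactness of the unit balls; the form <w, T a b> is jointly weakly
   continuous on them because w is a norm limit of finite sums of T x y. *)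
Lemma maximizer_ex w : exists a b, [/\ `|a| <= 1, `|b| <= 1 &
  forall a' b', `|a'| <= 1 -> `|b'| <= 1 -> inner w (T a' b') <= inner w (T a b)].
Proof.
pose S := [set inner w (T p.1 p.2) | p in [set p | `|p.1| <= 1 /\ `|p.2| <= 1]].
have hS : has_sup S.
  split; first by exists (inner w (T 0 0)), (0, 0); rewrite //= !normr0.
  exists `|w| => _ [[a b] /= [a1 b1] <-].
  rewrite (le_trans (inner_le _ _)) // norm_tmap ler_piMr // mulr_ile1 //.
have /choice[p Hp] n : exists p : L * K, [/\ `|p.1| <= 1, `|p.2| <= 1 &
    sup S - n.+1%:R^-1 < inner w (T p.1 p.2)].
  have n0 : 0 < n.+1%:R^-1 :> R by rewrite invr_gt0.
  by have [_ [q [q1 q2] <-] Hq] := sup_adherent n0 hS; exists q.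
have [U [FU UF]] := ultraFilterLemma eventually_filter.
have [|a a1 Ha] := @weak_limit _ _ U FU (fun n => (p n).1); first by move=> n; have [] := Hp n.
have [|b b1 Hb] := @weak_limit _ _ U FU (fun n => (p n).2); first by move=> n; have [] := Hp n.
have Ha' x : (fun n => inner x (p n).1) @ U --> inner x a.
  by under eq_fun do rewrite innerC; rewrite innerC; exact: Ha.
have Hb' x : (fun n => inner x (p n).2) @ U --> inner x b.
  by under eq_fun do rewrite innerC; rewrite innerC; exact: Hb.
exists a, b; split=> // a' b' a'1 b'1.
apply: (@le_trans _ _ (sup S)).
  by apply: ub_le_sup; [exact: hS.2|exists (a', b')].
apply/ler_addgt0Pr => e e0.
have e4 : 0 < e / 4 by rewrite divr_gt0.
have [y [n [c [z [Hz yE]]]] wy] := dense_approx w tT.2 e4.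
have ycvg : (fun n => inner y (T (p n).1 (p n).2)) @ U --> inner y (T a b).
  rewrite yE; under eq_fun do rewrite inner_suml; rewrite inner_suml.
  apply: cvg_big => [|j _]; first exact: add_continuous.
  have [[x1 x2] _ <-] := Hz j => /=.
  under eq_fun do rewrite innerZl innerT; rewrite innerZl innerT.
  apply: cvgM; first exact: cvg_cst.
  by apply: cvgM; [exact: Ha' | exact: Hb'].
have close x1 x2 : `|x1| <= 1 -> `|x2| <= 1 ->
    `|inner w (T x1 x2) - inner y (T x1 x2)| <= e / 4.
  move=> x11 x21; rewrite -innerBl (le_trans (cauchy_schwarz _ _)) // norm_tmap.
  by rewrite (le_trans _ (ltW wy)) // ler_piMr // mulr_ile1.
have : sup S - e / 4 <= inner y (T a b).
  apply: (ler_cvg_filter (F := U) (f := fun n => sup S - n.+1%:R^-1 - e / 4)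
    _ _ ycvg) => [|k].
    apply: cvgB; last exact: cvg_cst.
    rewrite -[X in _ --> X]subr0; apply: cvgB; first exact: cvg_cst.
    by move=> A /(@cvg_harmonic R A); exact: UF.
  have [k1 k2 k3] := Hp k; have := close _ _ k1 k2; rewrite ler_norml => /andP[].
  by move: k3; set q := k.+1%:R^-1; lra.
have := close _ _ a1 b1; rewrite ler_norml => /andP[] H1 H2 H3.
lra.
Qed.

End TensorMap.

Section TopTriple.
Context {R : realType} {L K W : hilbert R} {T : L -> K -> W}.
Hypothesis tT : tensor_map T.

(** The slice of w at b has norm at most s and pairs with the unit vector a to s; this equality case
    of Cauchy-Schwarz forces it to be s a. *)
Lemma maximizer_slice w a b (s : R) : 0 <= s -> `|a| = 1 -> `|b| = 1 ->
  (forall a' b', inner w (T a' b') <= s * (`|a'| * `|b'|)) ->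
  inner w (T a b) = s -> forall a', inner w (T a' b) = s * inner a' a.
Proof.
move=> s0 a1 b1 ws wab a'.
have le_s : `|slice tT w b| <= s.
  have := ws (slice tT w b) b; rewrite -(sliceE tT) inner_norm b1 mulr1.
  have [->|x0] := eqVneq (slice tT w b) 0; first by rewrite normr0.
  by rewrite expr2 ler_pM2r // normr_gt0.
have : `|slice tT w b - s *: a| ^+ 2 <= 0.
  rewrite norm_sqrB innerZr sliceE wab normrZ a1 mulr1 (ger0_norm s0).
  have : `|slice tT w b| ^+ 2 <= s ^+ 2 by rewrite ler_sqr ?nnegrE.
  nra.
rewrite -inner_norm => H.
have /inner_eq0/eqP : inner (slice tT w b - s *: a) (slice tT w b - s *: a) = 0.
  by apply/eqP; rewrite eq_le H inner_ge0.
by rewrite subr_eq0 -(sliceE tT) => /eqP ->; rewrite innerZl innerC.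
Qed.

End TopTriple.

Section Schmidt.
Context {R : realType} {L K W : hilbert R} {T : L -> K -> W}.
Hypothesis tT : tensor_map T.
Let innerT a b a' b' : inner (T a b) (T a' b') = inner a a' * inner b b'.
Proof. exact: tT.1. Qed.

Lemma tmap0l b : T 0 b = 0.
Proof. by rewrite -(scale0r 0) (tmapZl tT) scale0r. Qed.

Lemma tmap0r a : T a 0 = 0.
Proof. by rewrite -(scale0r 0) (tmapZr tT) scale0r. Qed.

Lemma top_triple w : exists (s : R) a b, [/\ 0 <= s,
  s != 0 -> inner a a = 1 /\ inner b b = 1,
  forall a' b', inner w (T a' b') <= s * (`|a'| * `|b'|),
  forall a', inner w (T a' b) = s * inner a' a &
  forall b', inner w (T a b') = s * inner b b'].
Proof.
have [a [b [a1 b1 ab]]] := maximizer_ex tT w.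
set s := inner w (T a b) in ab.
have s0 : 0 <= s by have := ab 0 0; rewrite !normr0 tmap0l inner0r; exact.
have ws a' b' : inner w (T a' b') <= s * (`|a'| * `|b'|).
  have [->|a'0] := eqVneq a' 0; first by rewrite tmap0l inner0r normr0 mul0r mulr0.
  have [->|b'0] := eqVneq b' 0; first by rewrite tmap0r inner0r normr0 !mulr0.
  have an : 0 < `|a'| by rewrite normr_gt0.
  have bn : 0 < `|b'| by rewrite normr_gt0.
  have := ab (`|a'|^-1 *: a') (`|b'|^-1 *: b').
  rewrite !normrZ !ger0_norm ?invr_ge0 // !mulVf ?gt_eqF // lexx.
  move=> /(_ isT isT); rewrite (tmapZl tT) (tmapZr tT) !innerZr.
  rewrite ler_pdivrMl // ler_pdivrMl //.
  by move=> /le_trans; apply; rewrite le_eqVlt; apply/orP; left; apply/eqP; ring.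
have [s00|s_neq0] := eqVneq s 0.
  exists 0, 0, 0; split=> //.
  - by rewrite eqxx.
  - by move=> a' b'; rewrite -s00.
  - by move=> a'; rewrite tmap0r inner0r mul0r.
  - by move=> b'; rewrite tmap0l inner0r mul0r.
have sp : 0 < s by rewrite lt_neqAle eq_sym s_neq0.
have ab1 : 1 <= `|a| * `|b| by have := ws a b; rewrite -/s -{1}[s]mulr1 ler_pM2l.
have a_1 : `|a| = 1.
  by apply/eqP; rewrite eq_le a1 /= (le_trans ab1) // ler_piMr.
have b_1 : `|b| = 1.
  by apply/eqP; rewrite eq_le b1 /= (le_trans ab1) // ler_piMl.
exists s, a, b; split=> // [_|a'|b'].
- by rewrite !inner_norm a_1 b_1 expr1n.
- exact: (maximizer_slice tT).
- rewrite (innerC b); apply: (maximizer_slice (tmap_flip tT)) => // x y.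
  by rewrite (mulrC `|x|).
Qed.

(* Greedy deflation: subtract best rank-one approximations. *)
Lemma schmidt_ex (w : W) : exists (s : nat -> R) (a : nat -> L) (b : nat -> K),
  [/\ (forall i, 0 <= s i) /\ (forall i j, (i <= j)%N -> s j <= s i),
      ortho_on (fun i => s i != 0) b, ortho_on (fun i => s i != 0) a &
      series (fun i => s i *: T (a i) (b i)) @ \oo --> (w : W)].
Proof.
have /choice[f Hf] v : exists p : R * L * K, [/\ 0 <= p.1.1,
  p.1.1 != 0 -> inner p.1.2 p.1.2 = 1 /\ inner p.2 p.2 = 1,
  forall a' b', inner v (T a' b') <= p.1.1 * (`|a'| * `|b'|),
  forall a', inner v (T a' p.2) = p.1.1 * inner a' p.1.2 &
  forall b', inner v (T p.1.2 b') = p.1.1 * inner p.2 b'].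
  by have [s [a [b H]]] := top_triple v; exists (s, a, b).
pose next v := v - (f v).1.1 *: T (f v).1.2 (f v).2.
pose r n := iter n next w.
pose s n := (f (r n)).1.1; pose a n := (f (r n)).1.2; pose b n := (f (r n)).2.
have rS n : r n.+1 = r n - s n *: T (a n) (b n) by [].
have s0 n : 0 <= s n by have [] := Hf (r n).
have nab n : s n != 0 -> inner (a n) (a n) = 1 /\ inner (b n) (b n) = 1.
  by have [] := Hf (r n).
have ws n a' b' : inner (r n) (T a' b') <= s n * (`|a'| * `|b'|).
  by have [] := Hf (r n).
have wl n a' : inner (r n) (T a' (b n)) = s n * inner a' (a n).
  by have [] := Hf (r n).
have wr n b' : inner (r n) (T (a n) b') = s n * inner (b n) b'.
  by have [] := Hf (r n).
(* Once step j is done, the remainder vanishes on a_j in the first slot and on b_j in the second,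
   and later deflations preserve this. *)
have kill n j : (j < n)%N -> s j != 0 ->
    (forall a', inner (r n) (T a' (b j)) = 0) /\
    (forall b', inner (r n) (T (a j) b') = 0).
  elim: n => // n IH; rewrite ltnS leq_eqVlt => /orP[/eqP ->|jn] sj.
    have [a1 b1] := nab _ sj.
    split=> x; rewrite rS innerBl innerZl innerT ?wl ?wr ?a1 ?b1.
      by rewrite mulr1 (innerC x) subrr.
    by rewrite mul1r subrr.
  have [Hl Hr] := IH jn sj.
  split=> x; rewrite rS innerBl innerZl innerT ?Hl ?Hr.
    by have := Hl (a n); rewrite wr mulrCA => ->; rewrite mulr0 subr0.
  have := Hr (b n); rewrite wl mulrA (innerC (a j)) => ->.
  by rewrite mul0r subr0.
have oa i j : (j < i)%N -> s j != 0 -> s i * inner (a i) (a j) = 0.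
  by move=> ji sj; have [_ H] := kill _ _ ji sj; have := H (b i); rewrite wl innerC.
have ob i j : (j < i)%N -> s j != 0 -> s i * inner (b i) (b j) = 0.
  by move=> ji sj; have [H _] := kill _ _ ji sj; have := H (a i); rewrite wr.
(* The maximising pair of step n + 1 is orthogonal to the term just subtracted, so [r n] takes the
   same value on it, and the bound by [s n] applies. *)
have sS n : s n.+1 <= s n.
  have [->|sn] := eqVneq (s n.+1) 0; first exact: s0.
  have [a1 b1] := nab _ sn.
  have <- : inner (r n.+1) (T (a n.+1) (b n.+1)) = s n.+1 by rewrite wl a1 mulr1.
  rewrite rS innerBl innerZl innerT.
  have -> : s n * (inner (a n) (a n.+1) * inner (b n) (b n.+1)) = 0.
    have [->|snn] := eqVneq (s n) 0; first by rewrite mul0r.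
    have /eqP := oa _ _ (ltnSn n) snn; rewrite mulf_eq0 (negbTE sn) /= innerC.
    by move/eqP => ->; rewrite mul0r mulr0.
  rewrite subr0 (le_trans (ws _ _ _)) //.
  have -> : `|a n.+1| = 1.
    by apply/eqP; rewrite -(@eqrXn2 _ 2) // -inner_norm a1 expr1n.
  have -> : `|b n.+1| = 1.
    by apply/eqP; rewrite -(@eqrXn2 _ 2) // -inner_norm b1 expr1n.
  by rewrite !mulr1.
(* Hence |r m - r n|^2 = |r n|^2 - |r m|^2 for n <= m, which makes the remainders a Cauchy
   sequence. *)
have rr n k : inner (r (n + k)%N) (r n) = `|r (n + k)%N| ^+ 2.
  elim: k n => [|k IH] n; first by rewrite addn0 inner_norm.
  rewrite -(subrK (s n *: T (a n) (b n)) (r n)) -rS innerDr -addSnnS IH innerZr.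
  have [->|sn] := eqVneq (s n) 0; first by rewrite mul0r addr0.
  by rewrite (kill _ n _ sn).1 ?mulr0 ?addr0 // ltnS leq_addr.
have rn n : `|r n.+1| ^+ 2 = `|r n| ^+ 2 - s n ^+ 2.
  rewrite rS norm_sqrB innerZr wl normrZ (norm_tmap tT) !exprMn -!inner_norm.
  rewrite real_normK ?num_real //.
  have [->|sn] := eqVneq (s n) 0; first by rewrite expr0n /=; ring.
  by have [-> ->] := nab _ sn; ring.
have dec : nonincreasing_seq (fun n => `|r n| ^+ 2).
  by apply/nonincreasing_seqP => n; rewrite rn gerBl sqr_ge0.
have /cvg_ex[/= l rl] : cvgn (fun n => `|r n| ^+ 2).
  apply: nonincreasing_is_cvgn => //; exists 0 => _ [n _ <-]; exact: sqr_ge0.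
have lr n : l <= `|r n| ^+ 2.
  rewrite -(cvg_lim (@Rhausdorff R) rl); apply: nonincreasing_cvgn_ge => //.
  by apply/cvg_ex; exists l.
have [|//|r_oo r_cvg] := @cauchy_modulus_cvg _ _ r (fun n => `|r n| ^+ 2 - l).
- move=> n m /subnKC <-; rewrite norm_sqrB rr.
  by have := lr (n + (m - n))%N; lra.
- by rewrite -[X in _ --> X](subrr l); apply: cvgB => //; exact: cvg_cst.
have s20 : (fun n => s n ^+ 2) @ \oo --> (0 : R).
  have -> : (fun n => s n ^+ 2) = (fun n => `|r n| ^+ 2 - `|r n.+1| ^+ 2).
    by apply/funext => n; rewrite rn; ring.
  rewrite -(subrr l); apply: cvgB => //.
  by have := rl; rewrite -(cvg_shiftS (fun n => `|r n| ^+ 2)).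
(* |<r n, T a' b'>| is at most [s n] |a'| |b'| and [s n] tends to 0, so the limit pairs to zero with
   every elementary tensor. *)
have r_oo0 : r_oo = 0.
  apply: (eq_tmap tT) => a' b'; rewrite inner0l.
  apply/eqP; rewrite -sqrf_eq0 eq_le sqr_ge0 andbT.
  have c1 : (fun n => inner (r n) (T a' b') ^+ 2) @ \oo --> inner r_oo (T a' b') ^+ 2.
    by rewrite expr2; under eq_fun do rewrite expr2; apply: cvgM; exact: cvg_inner.
  have c2 : (fun n => s n ^+ 2 * (`|a'| * `|b'|) ^+ 2) @ \oo --> 0 * (`|a'| * `|b'|) ^+ 2.
    by apply: cvgM => //; exact: cvg_cst.
  rewrite -(mul0r ((`|a'| * `|b'|) ^+ 2)).
  apply: (ler_cvg_filter _ c1 c2) => n.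
  rewrite -exprMn -[leLHS]real_normK ?num_real // ler_sqr ?nnegrE ?mulr_ge0 //.
  rewrite ler_norml ws andbT lerNl -innerNr -scaleN1r -(tmapZl tT).
  by rewrite (le_trans (ws _ _ _)) // normrZ normrN1 mul1r.
have ortho (H : hilbert R) (e : nat -> H) :
    (forall i j, (j < i)%N -> s j != 0 -> s i * inner (e i) (e j) = 0) ->
    (forall i, s i != 0 -> inner (e i) (e i) = 1) ->
    ortho_on (fun i => s i != 0) e.
  move=> oe e1 i j si sj; case: (ltngtP i j) => [ij|ji|->].
  - have /eqP := oe _ _ ij si; rewrite mulf_eq0 (negbTE sj) /= innerC.
    by move=> /eqP.
  - by have /eqP := oe _ _ ji sj; rewrite mulf_eq0 (negbTE si) /= => /eqP.
  - by rewrite e1.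
exists s, a, b; split.
- split=> // i j ij; move: i j ij; apply: (@homo_leq _ s (fun x y => y <= x)) => //.
  by move=> y x z xy yz; exact: le_trans yz xy.
- by apply: ortho => // i si; have [] := nab _ si.
- by apply: ortho => // i si; have [] := nab _ si.
have -> : series (fun i => s i *: T (a i) (b i)) = (fun n => w - r n).
  apply/funext => n; rewrite /series /=; elim: n => [|n IH].
    by rewrite big_geq // subrr.
  by rewrite big_nat_recr // IH rS opprB addrA addrAC.
rewrite -[X in _ --> X]subr0 -r_oo0; apply: cvgB => //; exact: cvg_cst.
Qed.

Lemma slice_svd w : exists p, is_svd (slice tT w) p.
Proof.
have [s [a [b [s0 ob oa cv]]]] := schmidt_ex w.
exists (s, b, a); split=> // x.
rewrite (_ : series _ = fun n => slice tT (series (fun i => s i *: T (a i) (b i)) n) x).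
  exact: cvg_slice.
apply/funext => n; rewrite /series /= (slice_suml tT).
by apply: eq_bigr => i _; rewrite (sliceZl tT) (slice_tmap tT) scalerA innerC.
Qed.

(* The expansion converges to some w' since the squares of s are summable, and
   w' has the same slices as w. *)
Lemma svd_expansion (w : W) s b a : is_svd (slice tT w) (s, b, a) ->
  series (fun i => s i *: T (a i) (b i)) @ \oo --> (w : W).
Proof.
case=> -[s0 sdec] ob oa cv.
have pair x y : (fun n => \sum_(0 <= i < n) s i * (inner y (a i) * inner x (b i))) @ \oo
    --> inner w (T y x).
  rewrite -(sliceE tT) (_ : (fun n => _) =
    fun n => inner (series (fun i => (s i * inner x (b i)) *: a i) n) y).
    exact: cvg_inner.
  apply/funext => n; rewrite /series /= inner_suml.
  by apply: eq_bigr => i _; rewrite innerZl (innerC y); ring.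
have oT : ortho_on (fun i => s i != 0) (fun i => T (a i) (b i)).
  by move=> i j si sj; rewrite innerT oa // ob // -natrM mulnb andbb.
have wT i : s i != 0 -> inner w (T (a i) (b i)) = s i.
  move=> si; apply: (cvg_unique _ (pair (b i) (a i))) => //.
  apply: cvg_near_cst; exists i.+1 => // n /= ni.
  rewrite (bigD1_seq i) /=; last 2 first.
  - by rewrite mem_index_iota.
  - exact: iota_uniq.
  rewrite oa // ob // eqxx !mulr1 big1 ?addr0 // => j ji.
  have [->|sj] := eqVneq (s j) 0; first by rewrite mul0r.
  by rewrite oa // eq_sym (negbTE ji) mul0r mulr0.
have sumE (F : nat -> W) m n : \sum_(m <= i < n) s i *: F i =
    \sum_(m <= i < n | s i != 0) s i *: F i.
  rewrite [LHS](bigID (fun i => s i != 0)) /= [X in _ + X]big1 ?addr0 // => i.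
  by rewrite negbK => /eqP ->; rewrite scale0r.
have sumE2 m n : \sum_(m <= i < n) s i ^+ 2 = \sum_(m <= i < n | s i != 0) s i ^+ 2.
  rewrite [LHS](bigID (fun i => s i != 0)) /= [X in _ + X]big1 ?addr0 // => i.
  by rewrite negbK => /eqP ->; rewrite expr0n.
have bounded n : \sum_(0 <= i < n) s i ^+ 2 <= `|w| ^+ 2.
  rewrite sumE2; apply: le_trans (bessel w (iota_uniq 0 (n - 0)) oT).
  by apply: ler_sum => i si; rewrite wT.
have nd : nondecreasing_seq (fun n => \sum_(0 <= i < n) s i ^+ 2).
  by apply/nondecreasing_seqP => n; rewrite big_nat_recr //= lerDl sqr_ge0.
have /cvg_ex[/= l sl] : cvgn (fun n => \sum_(0 <= i < n) s i ^+ 2).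
  apply: nondecreasing_is_cvgn => //; exists (`|w| ^+ 2) => _ [n _ <-].
  exact: bounded.
have ls n : \sum_(0 <= i < n) s i ^+ 2 <= l.
  rewrite -(cvg_lim (@Rhausdorff R) sl).
  apply: (@nondecreasing_cvgn_le _ (fun n => \sum_(0 <= i < n) s i ^+ 2)) => //.
  by apply/cvg_ex; exists l.
have [||w' w'cvg] := @cauchy_modulus_cvg _ _ (series (fun i => s i *: T (a i) (b i)))
  (fun n => l - \sum_(0 <= i < n) s i ^+ 2).
- move=> n m nm; rewrite /series /= (big_cat_nat (n := n)) //= addrAC subrr add0r.
  rewrite sumE norm_ortho_sum ?iota_uniq // -sumE2 lerBrDl.
  by rewrite -big_cat_nat.
- by rewrite -[X in _ --> X](subrr l); apply: cvgB => //; exact: cvg_cst.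
suff -> : w = w' by [].
apply: (eq_tmap tT) => y x; apply: (cvg_unique _ (pair x y)) => //.
rewrite (_ : (fun n => _) =
  fun n => inner (series (fun i => s i *: T (a i) (b i)) n) (T y x)).
  exact: cvg_inner.
apply/funext => n; rewrite /series /= inner_suml.
by apply: eq_bigr => i _; rewrite innerZl innerT (innerC y) (innerC x).
Qed.

End Schmidt.

(** * Soft thresholding *)

Section Thresholding.
Context {R : realType} {L K W : hilbert R} {T : L -> K -> W}.
Hypothesis tT : tensor_map T.
Let innerT a b a' b' : inner (T a b) (T a' b') = inner a a' * inner b b'.
Proof. exact: tT.1. Qed.

(** An SVD in the sense of [is_svd] converges pointwise as an operator; here the series converges in
    the norm of W, which the norm of a residual requires. *)
Definition schmidt_decomp (w : W) (s : nat -> R) (a : nat -> L) (b : nat -> K) :=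
  [/\ (forall i, 0 <= s i) /\ (forall i j, (i <= j)%N -> s j <= s i),
      ortho_on (fun i => s i != 0) a, ortho_on (fun i => s i != 0) b &
      series (fun i => s i *: T (a i) (b i)) @ \oo --> (w : W)].

Lemma svd_schmidt w s b a : is_svd (slice tT w) (s, b, a) -> schmidt_decomp w s a b.
Proof.
by move=> H; have := svd_expansion H; case: H => -[? ?] ? ? _ ?; split.
Qed.

Section Decomposition.
Variables (w : W) (s : nat -> R) (a : nat -> L) (b : nat -> K).
Hypothesis sch : schmidt_decomp w s a b.

Let s0 i : 0 <= s i. Proof. by case: sch => -[]. Qed.
Let sdec i j : (i <= j)%N -> s j <= s i. Proof. by case: sch => -[_ H] _ _ _; exact: H. Qed.
Let oa : ortho_on (fun i => s i != 0) a. Proof. by case: sch. Qed.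
Let ob : ortho_on (fun i => s i != 0) b. Proof. by case: sch. Qed.

Lemma schmidt_ortho : ortho_on (fun i => s i != 0) (fun i => T (a i) (b i)).
Proof. by move=> i j si sj; rewrite innerT oa // ob // -natrM mulnb andbb. Qed.

Lemma schmidt_cvg_inner z :
  (fun n => \sum_(0 <= i < n) s i * inner (T (a i) (b i)) z) @ \oo --> inner w z.
Proof.
rewrite (_ : (fun n => _) = fun n => inner (series (fun i => s i *: T (a i) (b i)) n) z).
  by apply: cvg_inner; case: sch.
apply/funext => n; rewrite /series /= inner_suml.
by apply: eq_bigr => i _; rewrite innerZl.
Qed.

Lemma schmidt_inner i : s i != 0 -> inner w (T (a i) (b i)) = s i.
Proof.
move=> si; have H := schmidt_cvg_inner (z := T (a i) (b i)); apply: (cvg_unique _ H) => //.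
apply: cvg_near_cst; exists i.+1 => // n /= ni.
rewrite (bigD1_seq i) /=; last 2 first.
- by rewrite mem_index_iota.
- exact: iota_uniq.
rewrite schmidt_ortho // eqxx mulr1 big1 ?addr0 // => j ji.
have [->|sj] := eqVneq (s j) 0; first by rewrite mul0r.
by rewrite schmidt_ortho // (negbTE ji) mulr0.
Qed.

Lemma schmidt_inner_l i y : s i != 0 -> inner w (T (a i) y) = s i * inner (b i) y.
Proof.
move=> si; have H := schmidt_cvg_inner (z := T (a i) y); apply: (cvg_unique _ H) => //.
apply: cvg_near_cst; exists i.+1 => // n /= ni.
rewrite (bigD1_seq i) /=; last 2 first.
- by rewrite mem_index_iota.
- exact: iota_uniq.
rewrite innerT oa // eqxx mul1r big1 ?addr0 // => j ji.
have [->|sj] := eqVneq (s j) 0; first by rewrite mul0r.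
by rewrite innerT oa // (negbTE ji) mul0r mulr0.
Qed.

Lemma schmidt_inner_r i x : s i != 0 -> inner w (T x (b i)) = s i * inner (a i) x.
Proof.
move=> si; have H := schmidt_cvg_inner (z := T x (b i)); apply: (cvg_unique _ H) => //.
apply: cvg_near_cst; exists i.+1 => // n /= ni.
rewrite (bigD1_seq i) /=; last 2 first.
- by rewrite mem_index_iota.
- exact: iota_uniq.
rewrite innerT ob // eqxx mulr1 big1 ?addr0 // => j ji.
have [->|sj] := eqVneq (s j) 0; first by rewrite mul0r.
by rewrite innerT ob // (negbTE ji) !mulr0.
Qed.

Lemma sum_support (H : lmodType R) (c : nat -> R) (F : nat -> H) n :
  (forall i, s i = 0 -> c i = 0) ->
  \sum_(0 <= i < n) c i *: F i = \sum_(0 <= i < n | s i != 0) c i *: F i.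
Proof.
move=> cs; rewrite [LHS](bigID (fun i => s i != 0)) /= [X in _ + X]big1 ?addr0 // => i.
by rewrite negbK => /eqP /cs ->; rewrite scale0r.
Qed.

Lemma norm_schmidt_sum (H : hilbert R) (e : nat -> H) (c : nat -> R) n :
  ortho_on (fun i => s i != 0) e -> (forall i, s i = 0 -> c i = 0) ->
  `|\sum_(0 <= i < n) c i *: e i| ^+ 2 = \sum_(0 <= i < n) c i ^+ 2.
Proof.
move=> oe cs; rewrite sum_support // norm_ortho_sum ?iota_uniq //.
rewrite [RHS](bigID (fun i => s i != 0)) /= [X in _ + X]big1 ?addr0 // => i.
by rewrite negbK => /eqP /cs ->; rewrite expr0n.
Qed.

(** The operator norm of a diagonal operator: contracting with x leaves coefficients c_i <a_i, x> in
    an orthonormal system, and Bessel's inequality bounds the sum of their squares by g^2 |x|^2. The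
    first condition on c discards the indices at which a and b are arbitrary. *)
Lemma schmidt_sum_bound (c : nat -> R) (g : R) n x y :
  (forall i, s i = 0 -> c i = 0) -> (forall i, 0 <= c i <= g) ->
  inner (\sum_(0 <= i < n) c i *: T (a i) (b i)) (T x y) <= g * (`|x| * `|y|).
Proof.
move=> cs cg; have g0 : 0 <= g by have /andP[/le_trans H /H] := cg 0%N.
set v := \sum_(0 <= i < n) (c i * inner (a i) x) *: b i.
have -> : inner (\sum_(0 <= i < n) c i *: T (a i) (b i)) (T x y) = inner v y.
  rewrite !inner_suml; apply: eq_bigr => i _.
  by rewrite !innerZl innerT mulrA.
apply: le_trans (inner_le _ _) _; rewrite mulrA ler_wpM2r //.
rewrite -ler_sqr ?nnegrE ?mulr_ge0 // norm_schmidt_sum // => [|i /cs ->]; last first.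
  by rewrite mul0r.
rewrite exprMn (le_trans (y := g ^+ 2 * \sum_(0 <= i < n | s i != 0) inner x (a i) ^+ 2)) //.
  rewrite (bigID (fun i => s i != 0)) /= [X in _ + X]big1 ?addr0; last first.
    by move=> i; rewrite negbK => /eqP /cs ->; rewrite mul0r expr0n.
  rewrite mulr_sumr; apply: ler_sum => i _; rewrite exprMn (innerC x).
  have /andP[c0 cle] := cg i.
  by rewrite ler_wpM2r ?sqr_ge0 // ler_sqr ?nnegrE.
by rewrite ler_wpM2l ?sqr_ge0 // bessel // iota_uniq.
Qed.

Lemma schmidt_sqr_sum n : \sum_(0 <= i < n) s i ^+ 2 <= `|w| ^+ 2.
Proof.
rewrite (bigID (fun i => s i != 0)) /= [X in _ + X]big1 ?addr0; last first.
  by move=> i; rewrite negbK => /eqP ->; rewrite expr0n.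
apply: le_trans (bessel w (iota_uniq 0 (n - 0)) schmidt_ortho).
by apply: ler_sum => i si; rewrite schmidt_inner.
Qed.

Lemma sv_count (al : R) : 0 < al -> exists m, forall i, (i < m)%N = (al < s i).
Proof.
move=> al0.
have [n Hn] : exists n, s n <= al.
  have al2 : 0 < al ^+ 2 by rewrite exprn_gt0.
  (* If [s n] exceeded al for this n, the first n + 1 squares would sum to more than |w|^2. *)
  exists (Num.truncn (`|w| ^+ 2 / al ^+ 2)).
  rewrite leNgt; apply/negP => Hn.
  have := truncnS_gt (`|w| ^+ 2 / al ^+ 2); set n := Num.truncn _ in Hn *.
  rewrite ltr_pdivrMr // ltNge => /negP; apply.
  apply: le_trans (schmidt_sqr_sum n.+1).
  rewrite -[X in X%:R](subn0 n.+1) mulr_natl -sumr_const_nat.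
  rewrite big_seq [leRHS]big_seq; apply: ler_sum => i; rewrite mem_index_iota ltnS => /= ni.
  by rewrite ler_sqr ?nnegrE ?(ltW al0) // (le_trans (ltW Hn)) // sdec.
have exn : exists n, s n <= al by exists n.
exists (ex_minn exn) => i; case: ex_minnP => m sm mmin.
rewrite [RHS]ltNge; apply/idP/idP => [im|].
  by apply: contraL im => si; rewrite -leqNgt mmin.
by apply: contraNltn => mi; rewrite (le_trans _ sm) // sdec.
Qed.

(** Equals the thresholded tensor once n reaches the number of singular values above al:
    thresholding leaves a finite sum. *)
Definition thr_sum (al : R) n := \sum_(0 <= i < n) Num.max (s i - al) 0 *: T (a i) (b i).

Lemma thr_sum_stable (al : R) m n : (forall i, (i < m)%N = (al < s i)) ->
  (m <= n)%N -> thr_sum al n = thr_sum al m.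
Proof.
move=> mP mn; rewrite /thr_sum (big_cat_nat (n := m)) //=.
rewrite [X in _ + X]big_seq [X in _ + X]big1 ?addr0 // => i.
rewrite mem_index_iota => /andP[mi _].
by rewrite max_r ?scale0r // subr_le0 leNgt -mP -leqNgt.
Qed.

Lemma soft_thr_sv (al : R) i : 0 < al -> soft_thr al (s i) = Num.max (s i - al) 0.
Proof.
move=> al0; rewrite /soft_thr ger0_norm //.
have [->|si] := eqVneq (s i) 0; first by rewrite sgr0 mul0r max_r // sub0r oppr_le0 ltW.
by rewrite gtr0_sg ?mul1r // lt_neqAle eq_sym si s0.
Qed.

Lemma thr_coef0 (al : R) i : 0 < al -> s i = 0 -> Num.max (s i - al) 0 = 0.
Proof. by move=> al0 ->; rewrite max_r // sub0r oppr_le0 ltW. Qed.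

Lemma thr_minE (al x : R) : x - Num.max (x - al) 0 = Num.min x al.
Proof. by case: (ltP x al) => h; [rewrite max_r|rewrite max_l]; lra. Qed.

Section Residual.
Variables (al : R) (m : nat).
Hypothesis (al0 : 0 < al) (mP : forall i, (i < m)%N = (al < s i)).
Let p := thr_sum al m.

Let sum_res n : (m <= n)%N -> \sum_(0 <= i < n) s i *: T (a i) (b i) - p =
  \sum_(0 <= i < n) Num.min (s i) al *: T (a i) (b i).
Proof.
move=> mn; rewrite /p -(thr_sum_stable mP mn) -sumrB; apply: eq_bigr => i _.
by rewrite -scalerBl thr_minE.
Qed.

Let min0 i : s i = 0 -> Num.min (s i) al = 0.
Proof. by move=> ->; rewrite min_l // ltW. Qed.

(** The partial sums begin with m terms, so that each of them contains the whole sum p. *)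
Lemma residual_cvg :
  (fun n => \sum_(0 <= i < (n + m)%N) Num.min (s i) al *: T (a i) (b i)) @ \oo --> w - p.
Proof.
rewrite (_ : (fun n => _) = fun n => series (fun i => s i *: T (a i) (b i)) (n + m)%N - p).
  apply: cvgB; last exact: cvg_cst.
  by rewrite (cvg_shiftn m (series (fun i => s i *: T (a i) (b i)))); case: sch.
by apply/funext => n; rewrite -sum_res // leq_addl.
Qed.

Lemma residual_bound x y : inner (w - p) (T x y) <= al * (`|x| * `|y|).
Proof.
apply: (ler_cvg_filter _ (cvg_inner (y := T x y) residual_cvg)
  (cvg_cst (al * (`|x| * `|y|)))) => n.
apply: schmidt_sum_bound => // i.
by rewrite le_min s0 (ltW al0) /= ge_min lexx orbT.
Qed.

Lemma residual_norm (B : R) : (forall n, \sum_(0 <= i < n) Num.min (s i) al ^+ 2 <= B) ->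
  `|w - p| ^+ 2 <= B.
Proof.
move=> HB; have /(_ eventually_filter) H := cvg_norm residual_cvg.
have HH : (fun n => `|\sum_(0 <= i < (n + m)%N) Num.min (s i) al *: T (a i) (b i)| ^+ 2)
    @ \oo --> `|w - p| ^+ 2.
  by rewrite expr2; under eq_fun do rewrite expr2; exact: cvgM.
apply: (ler_cvg_filter _ HH (cvg_cst B)) => n.
by rewrite norm_schmidt_sum //; exact: schmidt_ortho.
Qed.

Let sm i : (i < m)%N -> s i != 0.
Proof. by rewrite mP => ai; rewrite gt_eqF // (lt_trans al0). Qed.

Lemma residual_inner i : (i < m)%N -> inner (w - p) (T (a i) (b i)) = al.
Proof.
move=> im; have si := sm im; rewrite innerBl schmidt_inner // inner_suml.
rewrite (bigD1_seq i) /=; last 2 first.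
- by rewrite mem_index_iota.
- exact: iota_uniq.
rewrite innerZl schmidt_ortho // eqxx mulr1 big1 ?addr0; last first.
  move=> j ji; rewrite innerZl.
  have [sj|sj] := eqVneq (s j) 0; first by rewrite thr_coef0 ?mul0r.
  by rewrite schmidt_ortho // (negbTE ji) mulr0.
by rewrite max_l ?subKr // subr_ge0 ltW // -mP.
Qed.

Lemma norm_schmidt_factor i : (i < m)%N -> `|a i| = 1 /\ `|b i| = 1.
Proof.
move=> /sm si; split; apply/eqP; rewrite -(@eqrXn2 _ 2) // -inner_norm.
  by rewrite oa // eqxx expr1n.
by rewrite ob // eqxx expr1n.
Qed.

(* w - p lies in al times the subdifferential of the nuclear norm at p *)
Lemma residual_subgradient (r : W) :
  (forall x y, inner r (T x y) <= al * (`|x| * `|y|)) ->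
  inner r p <= inner (w - p) p.
Proof.
have E z : inner z p = \sum_(0 <= i < m) Num.max (s i - al) 0 * inner z (T (a i) (b i)).
  by rewrite inner_sumr; apply: eq_bigr => i _; rewrite innerZr.
move=> rB; rewrite !E big_seq [leRHS]big_seq; apply: ler_sum => i.
rewrite mem_index_iota => /= im; rewrite residual_inner //.
rewrite ler_wpM2l ?le_max ?lexx ?orbT //.
by have [a1 b1] := norm_schmidt_factor im; have := rB (a i) (b i); rewrite a1 b1 !mulr1.
Qed.

End Residual.
End Decomposition.

(** A rank bound in the form of a decomposition, which is preserved by operators acting on one of
    the two factors. *)
Definition elem_rank (m : nat) (w : W) :=
  exists (x : 'I_m -> L) (y : 'I_m -> K), w = \sum_(j < m) T (x j) (y j).

(** If s_m were nonzero, the matrix of the <w, T a_i b_j>, i, j <= m, would be diagonal with nonzero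
    entries s_0, ..., s_m, yet it factors through dimension m. *)
Lemma elem_rank_sv w s a b m : schmidt_decomp w s a b -> elem_rank m w -> s m = 0.
Proof.
move=> sch [x [y wE]]; apply/eqP; apply: contrapT => /negP sm.
have [[s0 sdec] oa ob _] := sch.
have si (i : 'I_m.+1) : s i != 0.
  have mi : (i <= m)%N by rewrite -ltnS.
  have := sdec _ _ mi; apply: contraTneq => ->; rewrite -ltNge.
  by rewrite lt_neqAle eq_sym sm s0.
pose X := \matrix_(i < m.+1, k < m) inner (x k) (a i).
pose Y := \matrix_(k < m, j < m.+1) inner (y k) (b j).
have XY : X *m Y = diag_mx (\row_(i < m.+1) s i).
  apply/matrixP => i j; rewrite !mxE.
  transitivity (inner w (T (a i) (b j))).
    by rewrite wE inner_suml; apply: eq_bigr => k _; rewrite !mxE innerT.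
  apply: (cvg_unique _ (schmidt_cvg_inner (z := T (a i) (b j)) sch)) => //.
  apply: cvg_near_cst; exists i.+1 => // n /= ni.
  rewrite (bigD1_seq (i : nat)) /=; last 2 first.
  - by rewrite mem_index_iota.
  - exact: iota_uniq.
  rewrite innerT oa // eqxx mul1r big1 ?addr0; last first.
    move=> k ki; have [->|sk] := eqVneq (s k) 0; first by rewrite mul0r.
    by rewrite innerT oa // (negbTE ki) mul0r mulr0.
  by rewrite ob // mulr_natr.
have : (\rank (X *m Y) <= m)%N.
  by rewrite (leq_trans (mxrankM_maxl _ _)) // rank_leq_col.
rewrite XY mxrank_unit ?ltnn // unitmxE det_diag unitfE.
by apply/prodf_neq0 => i _; rewrite mxE.
Qed.

Lemma slice_inj w w' : slice tT w = slice tT w' -> w = w'.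
Proof. by move=> E; apply: (eq_tmap tT) => x y; rewrite -!(sliceE tT) E. Qed.

Lemma svd_slice w : exists s b a, svd (slice tT w) = (s, b, a) /\ schmidt_decomp w s a b.
Proof.
have := xgetPex point (slice_svd tT w); rewrite -/(svd (slice tT w)).
by case: (svd _) => -[s b] a /= H; exists s, b, a; split=> //; exact: svd_schmidt.
Qed.

Lemma soft_thr_op_slice w al s b a m : 0 < al -> svd (slice tT w) = (s, b, a) ->
  schmidt_decomp w s a b -> (forall i, (i < m)%N = (al < s i)) ->
  soft_thr_op al (slice tT w) = slice tT (thr_sum s a b al m).
Proof.
move=> al0 svdE sch mP; rewrite /soft_thr_op svdE; apply/funext => x.
apply: (cvg_lim (@norm_hausdorff _ L)).
apply: cvg_near_cst; exists m => // n /= mn.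
rewrite /series /= -(thr_sum_stable _ _ mP mn) /thr_sum (slice_suml tT).
apply: eq_bigr => i _; rewrite (soft_thr_sv sch) // (sliceZl tT) (slice_tmap tT).
by rewrite scalerA innerC.
Qed.

(** The counterpart of [soft_thr_at] for an abstract tensor map. For positive al the set contains a
    [thr_sum], so the default 0 is not a fallback there. *)
Definition sthr (al : R) (w : W) : W :=
  xget 0 [set p | slice tT p = soft_thr_op al (slice tT w)].

Lemma sthrP w al : 0 < al -> exists s b a m,
  [/\ singular_values (slice tT w) = s, schmidt_decomp w s a b,
      (forall i, (i < m)%N = (al < s i)) & sthr al w = thr_sum s a b al m].
Proof.
move=> al0; have [s [b [a [svdE sch]]]] := svd_slice w.
have [m mP] := sv_count sch al0.
exists s, b, a, m; split=> //; first by rewrite /singular_values svdE.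
apply: slice_inj; rewrite -(soft_thr_op_slice al0 svdE sch mP).
have := @xgetPex _ 0 [set p | slice tT p = soft_thr_op al (slice tT w)].
by apply; exists (thr_sum s a b al m); rewrite /= (soft_thr_op_slice al0 svdE sch mP).
Qed.

(** Monotonicity of a subdifferential: each residual is admissible in the subgradient inequality of
    the other tensor, and the sum of the two inequalities says that the cross term in the expansion
    of |v - w|^2 is nonnegative. *)
Lemma sthr_firm al v w : 0 < al ->
  `|sthr al v - sthr al w| ^+ 2 + `|(v - sthr al v) - (w - sthr al w)| ^+ 2 <=
  `|v - w| ^+ 2.
Proof.
move=> al0.
have [s [b [a [m [_ sch mP ->]]]]] := sthrP v al0.
have [s' [b' [a' [m' [_ sch' mP' ->]]]]] := sthrP w al0.
set p := thr_sum _ _ _ _ _; set q := thr_sum _ _ _ _ _.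
have H1 := residual_subgradient sch al0 mP (residual_bound sch' al0 mP').
have H2 := residual_subgradient sch' al0 mP' (residual_bound sch al0 mP).
rewrite -/p -/q in H1 H2.
have -> : v - w = (p - q) + (v - p - (w - q)).
  by rewrite opprB addrACA [p + _]addrC subrK addKr.
rewrite [leRHS]norm_sqrD.
have : 0 <= inner (p - q) (v - p - (w - q)).
  rewrite innerC innerBr; rewrite !innerBl in H1 H2 *; lra.
lra.
Qed.

Lemma sthr_nonexpansive al v w : 0 < al -> `|sthr al v - sthr al w| <= `|v - w|.
Proof.
move=> al0; rewrite -ler_sqr ?nnegrE //; apply: le_trans (sthr_firm v w al0).
by rewrite lerDl sqr_ge0.
Qed.

Lemma sthr_dist al w (B : R) : 0 < al ->
  (forall n, \sum_(0 <= i < n) Num.min (singular_values (slice tT w) i) al ^+ 2 <= B) ->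
  `|w - sthr al w| ^+ 2 <= B.
Proof.
move=> al0; have [s [b [a [m [-> sch mP ->]]]]] := sthrP w al0.
exact: residual_norm.
Qed.

Lemma sthr0 al w : 0 < al -> singular_values (slice tT w) 0%N <= al -> sthr al w = 0.
Proof.
move=> al0; have [s [b [a [m [-> sch mP ->]]]]] := sthrP w al0.
rewrite leNgt -mP -leqNgt leqn0 => /eqP ->.
by rewrite /thr_sum big_geq.
Qed.

(* Pair the difference of the residuals of v and u with q, the sum of the leading
   rank-one terms of v, whose norm squared is m. *)
Lemma sthr_elem_rank al u v N : 0 < al ->
  singular_values (slice tT u) N <= al / 2 ->
  exists2 m : nat, elem_rank m (sthr al v) &
    m%:R <= 2 * N%:R + 4 * (`|v - u| / al) ^+ 2.
Proof.
move=> al0 uN.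
have firm := sthr_firm v u al0.
have [s [b [a [m [_ sch mP vE]]]]] := sthrP v al0.
exists m.
  rewrite vE; exists (fun j : 'I_m => Num.max (s j - al) 0 *: a j), (fun j => b j).
  by rewrite /thr_sum big_mkord; apply: eq_bigr => j _; rewrite (tmapZl tT).
have [s' [b' [a' [m' [suE sch' mP' uE]]]]] := sthrP u al0.
rewrite suE in uN.
have a20 : 0 < al / 2 by rewrite divr_gt0.
have [N' NP'] := sv_count sch' a20.
have N'N : (N' <= N)%N by rewrite leqNgt NP' -leNgt.
have m'N' : (m' <= N')%N.
  rewrite leqNgt mP' -leNgt (@le_trans _ _ (al / 2)) //; first by rewrite leNgt -NP' ltnn.
  by rewrite ler_pdivrMr // ler_peMr ?(ltW al0) // ler1n.
have sm i : (i < m)%N -> s i != 0.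
  by rewrite mP => ai; rewrite gt_eqF // (lt_trans al0).
pose c i : R := (i < m)%:R.
have cs i : s i = 0 -> c i = 0.
  by rewrite /c mP => ->; rewrite ltNge (ltW al0).
set q := \sum_(0 <= i < m) c i *: T (a i) (b i).
have qn : `|q| ^+ 2 = m%:R.
  rewrite /q (norm_schmidt_sum _ (schmidt_ortho sch) cs).
  rewrite -[RHS]mulr1 mulr_natl -[in RHS](subn0 m) -sumr_const_nat.
  rewrite big_seq [RHS]big_seq; apply: eq_bigr => i.
  by rewrite mem_index_iota /c => /= ->; rewrite expr1n.
have qE z : inner z q = \sum_(0 <= i < m) inner z (T (a i) (b i)).
  rewrite inner_sumr big_seq [RHS]big_seq; apply: eq_bigr => i.
  by rewrite mem_index_iota /c innerZr => /= ->; rewrite mul1r.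
have nE (x : R) k : \sum_(0 <= i < k) x = k%:R * x.
  by rewrite sumr_const_nat subn0 mulr_natl.
have vq : inner (v - sthr al v) q = m%:R * al.
  rewrite qE vE -nE big_seq [RHS]big_seq; apply: eq_bigr => i.
  by rewrite mem_index_iota => /= im; rewrite (residual_inner sch).
(* The residual of u is split at the level al / 2. The residual at al / 2 has operator norm at most
   al / 2, so it pairs with the m terms of q to at most m al / 2. The difference of the two
   thresholdings has at most N rank-one terms with coefficients in [0, al / 2], and q has operator
   norm at most 1. *)
have uq : inner (u - sthr al u) q <= N%:R * (al / 2) + m%:R * (al / 2).
  rewrite uE -(thr_sum_stable _ _ mP' m'N').
  rewrite -(subrK (thr_sum s' a' b' (al / 2) N') u) -addrA innerDl [leRHS]addrC.
  apply: lerD; last first.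
    rewrite /thr_sum -sumrB inner_suml.
    apply: (@le_trans _ _ (N'%:R * (al / 2))); last first.
      by rewrite ler_wpM2r ?ler_nat // ltW.
    rewrite -nE big_seq [leRHS]big_seq; apply: ler_sum => i.
    rewrite mem_index_iota => /= iN'; rewrite -scalerBl innerZl innerC.
    have [a1 b1] := norm_schmidt_factor sch' a20 NP' iN'.
    have : inner q (T (a' i) (b' i)) <= 1.
      have := schmidt_sum_bound (g := 1) sch m (a' i) (b' i) cs.
      by rewrite a1 b1 !mulr1; apply => j; rewrite /c; case: (j < m)%N; rewrite lexx ler01.
    have : 0 <= Num.max (s' i - al / 2) 0 - Num.max (s' i - al) 0 <= al / 2.
      move: iN'; rewrite NP'; case: (leP (s' i - al) 0) => h1 h2.
        by rewrite max_l; lra.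
      by rewrite max_l; lra.
    move: (_ - _) (inner _ _) => x y; nra.
  rewrite qE -nE big_seq [leRHS]big_seq; apply: ler_sum => i.
  rewrite mem_index_iota => /= im.
  have [a1 b1] := norm_schmidt_factor sch al0 mP im.
  by have := residual_bound sch' a20 NP' (a i) (b i); rewrite a1 b1 !mulr1.
set D := `|v - sthr al v - (u - sthr al u)|.
have DQ : m%:R * al - (N%:R * (al / 2) + m%:R * (al / 2)) <= D * `|q|.
  by apply: le_trans (inner_le _ _); rewrite innerBl vq lerB.
have DD : D ^+ 2 <= `|v - u| ^+ 2.
  by apply: le_trans firm; rewrite lerDr sqr_ge0.
have -> : (`|v - u| / al) ^+ 2 = `|v - u| ^+ 2 / al ^+ 2 by rewrite exprMn exprVn.
apply: (@le_trans _ _ (2 * N%:R + 4 * (D ^+ 2 / al ^+ 2))); last first.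
  by rewrite lerD2l ler_wpM2l // ler_wpM2r // invr_ge0 sqr_ge0.
rewrite -(ler_pM2r (exprn_gt0 2 al0)) mulrDl -[4 * _ * _]mulrA mulfVK ?gt_eqF ?exprn_gt0 //.
(* Young's inequality: as |q|^2 = m, the product D |q| is at most m al / 4 + D^2 / al, and the first
   summand is absorbed by m al / 2. *)
rewrite -qn in DQ *; move: DQ (sqr_ge0 (`|q| * al - 2 * D)).
move: `|q| (D) => x y; nra.
Qed.

(** For fixed w, thresholding acts on w as a linear operator on the first factor alone, with
    eigenvectors a_i and eigenvalues [g i], because the contraction of w with a_i is s_i b_i. In
    this form it can be followed on the tensor factors of another edge. *)
Lemma sthr_slice_l al w : 0 < al -> exists k (g : 'I_k -> R) (a : 'I_k -> L),
  sthr al w = \sum_i g i *: T (a i) (slice (tmap_flip tT) w (a i)).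
Proof.
move=> al0; have [s [b [a [m [_ sch mP ->]]]]] := sthrP w al0.
exists m, (fun i => Num.max (s i - al) 0 / s i), a.
rewrite /thr_sum big_mkord; apply: eq_bigr => i _.
have si : s i != 0 by rewrite gt_eqF // (lt_trans al0) // -mP.
have -> : slice (tmap_flip tT) w (a i) = s i *: b i.
  apply: inner_ext => y; rewrite innerZl -(schmidt_inner_l sch _ si).
  exact: sliceE.
by rewrite (tmapZr tT) scalerA mulfVK.
Qed.

Lemma sthr_slice_r al w : 0 < al -> exists k (g : 'I_k -> R) (b : 'I_k -> K),
  sthr al w = \sum_i g i *: T (slice tT w (b i)) (b i).
Proof.
move=> al0; have [s [b [a [m [_ sch mP ->]]]]] := sthrP w al0.
exists m, (fun i => Num.max (s i - al) 0 / s i), b.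
rewrite /thr_sum big_mkord; apply: eq_bigr => i _.
have si : s i != 0 by rewrite gt_eqF // (lt_trans al0) // -mP.
have -> : slice tT w (b i) = s i *: a i.
  apply: inner_ext => y; rewrite innerZl -(schmidt_inner_r sch _ si).
  exact: sliceE.
by rewrite (tmapZl tT) scalerA mulfVK.
Qed.

End Thresholding.

(** * Tensor products over subsets of modes *)

Lemma linear_dense0 (R : realType) (K : hilbert R) (I : Type) (p : I -> K)
    (h : K -> R) : dense (lin_span (range p)) -> continuous h ->
  (forall c x y, h (c *: x + y) = c * h x + h y) -> (forall i, h (p i) = 0) ->
  forall x, h x = 0.
Proof.
move=> dp ch hl hp; apply: (dense_continuous0 dp ch) => _ [n [c [e [pe ->]]]].
elim/big_rec: _ => [|j x _ hx]; first by have := hl (-1) 0 0; rewrite scaler0 addr0 mulN1r addNr.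
by rewrite hl hx; have [i _ <-] := pe j; rewrite hp mulr0 addr0.
Qed.

Section TensorProducts.
Context {R : realType} {d : nat} {H : 'I_d -> hilbert R}.
Variable V : tensor_space H.
Implicit Types (A B C D : {set 'I_d}) (z : forall i, H i).

(** D is a variable and not the union itself, because sets that are only provably equal give
    different types [V D]; this avoids transports between them. *)
Definition splits B C D := [disjoint B & C]%B /\ (B :|: C)%SET = D.

Lemma splitsC B C D : splits B C D -> splits C B D.
Proof. by case=> dBC <-; split; [rewrite disjoint_sym|rewrite finset.setUC]. Qed.

(** As [pure V B z] depends only on the coordinates in B, one mixed family prescribes the factors
    over B and over a disjoint C independently. *)
Definition mix B z z' : forall i, H i := fun i => if i \in B then z i else z' i.

Lemma pure_ext A z z' : (forall i, i \in A -> z i = z' i) -> pure V A z = pure V A z'.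
Proof.
move=> zz'; apply/eqP; rewrite -subr_eq0; apply/eqP/inner_eq0.
rewrite !(innerBl, innerBr) !inner_pure.
have E (x y : forall i, H i) : (forall i, i \in A -> x i = z i) ->
    (forall i, i \in A -> y i = z i) ->
    \prod_(i in A) inner (x i) (y i) = \prod_(i in A) inner (z i) (z i).
  by move=> hx hy; apply: eq_bigr => i iA; rewrite hx ?hy.
by rewrite (E z' z) ?(E z z') ?(E z' z') ?subrr // => i /zz' ->.
Qed.

Lemma pure_mixl B z z' : pure V B (mix B z z') = pure V B z.
Proof. by apply: pure_ext => i iB; rewrite /mix iB. Qed.

Lemma pure_mixr B C z z' : [disjoint B & C]%B -> pure V C (mix B z z') = pure V C z'.
Proof.
by move=> dBC; apply: pure_ext => i iC; rewrite /mix (disjointFl dBC iC).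
Qed.

Lemma inner_pure_splits B C D z z' : splits B C D ->
  inner (pure V D z) (pure V D z') =
  inner (pure V B z) (pure V B z') * inner (pure V C z) (pure V C z').
Proof.
case=> dBC <-; rewrite !inner_pure -bigU //=.
by apply: eq_bigl => i; rewrite !inE.
Qed.

Section Tens.
Variables B C D : {set 'I_d}.
Hypothesis sp : splits B C D.

Lemma tens_span_ex x y : lin_span (range (pure V B)) x -> lin_span (range (pure V C)) y ->
  exists2 w : V D, `|w| = `|x| * `|y| &
    forall z, inner w (pure V D z) = inner x (pure V B z) * inner y (pure V C z).
Proof.
move=> [n [al [e [He xE]]]] [m [be [f [Hf yE]]]].
have /choice[e' He'] j : exists z, pure V B z = e j by have [z _ <-] := He j; exists z.
have /choice[f' Hf'] j : exists z, pure V C z = f j by have [z _ <-] := Hf j; exists z.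
have prodE (u : V B) (v : V C) : inner x u * inner y v =
    \sum_j \sum_k al j * be k * (inner (e j) u * inner (f k) v).
  rewrite xE yE !inner_suml big_distrlr; apply: eq_bigr => j _; apply: eq_bigr => k _ /=.
  by rewrite !innerZl; ring.
pose w := \sum_j \sum_k (al j * be k) *: pure V D (mix B (e' j) (f' k)).
have wE z : inner w (pure V D z) = inner x (pure V B z) * inner y (pure V C z).
  rewrite prodE inner_suml; apply: eq_bigr => j _.
  rewrite inner_suml; apply: eq_bigr => k _.
  by rewrite innerZl (inner_pure_splits _ _ sp) pure_mixl pure_mixr ?sp.1 // He' Hf'.
exists w => //.
apply/eqP; rewrite -(@eqrXn2 _ 2) ?mulr_ge0 // exprMn -!inner_norm prodE.
rewrite {2}/w inner_sumr; apply/eqP; apply: eq_bigr => j _.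
rewrite inner_sumr; apply: eq_bigr => k _.
rewrite innerZr wE pure_mixl pure_mixr ?sp.1 // He' Hf'.
by rewrite (innerC x) (innerC y).
Qed.

(** Density is used in one factor at a time: for x' a finite sum, testing against finite sums y'
    bounds [q' x']; this bound, paired with the given y, allows [q y] to be tested against finite
    sums x'. *)
Lemma tens_bound (s : seq (R * (forall i, H i))) x y :
  \sum_(p <- s) p.1 * (inner x (pure V B p.2) * inner y (pure V C p.2)) <=
  `|x| * `|y| * `|\sum_(p <- s) p.1 *: pure V D p.2|.
Proof.
set v := \sum_(p <- s) _ *: _.
pose q y' := \sum_(p <- s) (p.1 * inner y' (pure V C p.2)) *: pure V B p.2.
pose q' x' := \sum_(p <- s) (p.1 * inner x' (pure V B p.2)) *: pure V C p.2.
have qE x' y' : inner x' (q y') =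
    \sum_(p <- s) p.1 * (inner x' (pure V B p.2) * inner y' (pure V C p.2)).
  by rewrite inner_sumr; apply: eq_bigr => p _; rewrite innerZr -mulrA (mulrC (inner y' _)).
have q'E x' y' : inner y' (q' x') =
    \sum_(p <- s) p.1 * (inner x' (pure V B p.2) * inner y' (pure V C p.2)).
  by rewrite inner_sumr; apply: eq_bigr => p _; rewrite innerZr mulrA.
have bound' x' : lin_span (range (pure V B)) x' -> `|q' x'| <= `|x'| * `|v|.
  move=> Sx; apply: (dense_inner_bound (@dense_pure _ _ _ V C)); first by rewrite mulr_ge0.
  move=> y' Sy; have [w wn wE] := tens_span_ex Sx Sy.
  rewrite q'E [leRHS](_ : _ = `|w| * `|v|); last by rewrite wn; ring.
  apply: le_trans (inner_le w v); rewrite le_eqVlt; apply/orP; left; apply/eqP.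
  by rewrite inner_sumr; apply: eq_bigr => p _; rewrite innerZr wE.
have bound : `|q y| <= `|y| * `|v|.
  apply: (dense_inner_bound (@dense_pure _ _ _ V B)); first by rewrite mulr_ge0.
  move=> x' Sx; rewrite qE -q'E.
  by rewrite (le_trans (inner_le _ _)) // -mulrA ler_wpM2l // mulrC bound'.
by rewrite -qE (le_trans (inner_le _ _)) // -mulrA ler_wpM2l.
Qed.

(** The functional to be represented is prescribed on finite sums of pure tensors, whose expansions
    are not unique; the relation G contains all of them, and [tens_bound] makes it consistent. *)
Lemma tens_ex x y : exists2 w : V D, `|w| <= `|x| * `|y| &
  forall z, inner w (pure V D z) = inner x (pure V B z) * inner y (pure V C z).
Proof.
pose G (v : V D) (t : R) := exists s : seq (R * (forall i, H i)),
  v = \sum_(p <- s) p.1 *: pure V D p.2 /\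
  t = \sum_(p <- s) p.1 * (inner x (pure V B p.2) * inner y (pure V C p.2)).
have [||||w wM Hw] := @riesz_graph R (V D) G (`|x| * `|y|).
- by exists [::]; rewrite !big_nil.
- by rewrite mulr_ge0.
- move=> c v t v' t' [s [-> ->]] [s' [-> ->]].
  exists ([seq (c * p.1, p.2) | p <- s] ++ s'); rewrite !big_cat !big_map /=.
  split; congr (_ + _); rewrite ?scaler_sumr ?mulr_sumr; apply: eq_bigr => p _.
    by rewrite scalerA.
  by rewrite -mulrA.
- by move=> v t [s [-> ->]]; exact: tens_bound.
exists w => // z; apply: Hw; exists [:: (1, z)]; rewrite !big_seq1 /=.
by rewrite scale1r mul1r.
Qed.

End Tens.

(** The norm bound is part of the choice because it gives continuity in each argument before the
    exact inner product formula is known. *)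
Definition tens B C D (x : V B) (y : V C) : V D :=
  xget 0 [set w | `|w| <= `|x| * `|y| /\
    forall z, inner w (pure V D z) = inner x (pure V B z) * inner y (pure V C z)].

Lemma eq_pure A (x y : V A) :
  (forall z, inner x (pure V A z) = inner y (pure V A z)) -> x = y.
Proof. exact: eq_inner (@dense_pure _ _ _ V A). Qed.

Section TensTheory.
Variables B C D : {set 'I_d}.
Hypothesis sp : splits B C D.
Implicit Types (x : V B) (y : V C).

Let tensP x y : `|tens D x y| <= `|x| * `|y| /\
  forall z, inner (tens D x y) (pure V D z) = inner x (pure V B z) * inner y (pure V C z).
Proof.
have [w w1 w2] := tens_ex sp x y.
exact: (@xgetPex _ 0 [set w : V D | `|w| <= `|x| * `|y| /\
  forall z, inner w (pure V D z) = inner x (pure V B z) * inner y (pure V C z)]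
  (ex_intro _ w (conj w1 w2))).
Qed.

Lemma tensE x y z :
  inner (tens D x y) (pure V D z) = inner x (pure V B z) * inner y (pure V C z).
Proof. exact: (tensP x y).2. Qed.

Lemma tens_pure z : tens D (pure V B z) (pure V C z) = pure V D z.
Proof. by apply: eq_pure => z'; rewrite tensE -(inner_pure_splits _ _ sp). Qed.

Let tens_linl c x x' y : tens D (c *: x + x') y = c *: tens D x y + tens D x' y.
Proof.
by apply: eq_pure => z; rewrite innerDl innerZl !tensE innerDl innerZl; ring.
Qed.

Let tens_linr c x y y' : tens D x (c *: y + y') = c *: tens D x y + tens D x y'.
Proof.
by apply: eq_pure => z; rewrite innerDl innerZl !tensE innerDl innerZl; ring.
Qed.

Let continuousl y w : continuous (fun x => inner (tens D x y) w).
Proof.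
move=> x; apply: (@continuous_comp _ _ _ (fun x => tens D x y) (fun v => inner v w)).
  apply: (@bounded_additive_continuous _ _ _ _ `|y|) => [u v|u].
    by rewrite addrC -scaleN1r tens_linl scaleN1r addrC.
  by rewrite mulrC; exact: (tensP _ _).1.
exact: inner_continuousl.
Qed.

Let continuousr x w : continuous (fun y => inner (tens D x y) w).
Proof.
move=> y; apply: (@continuous_comp _ _ _ (fun y => tens D x y) (fun v => inner v w)).
  apply: (@bounded_additive_continuous _ _ _ _ `|x|) => [u v|u].
    by rewrite addrC -scaleN1r tens_linr scaleN1r addrC.
  exact: (tensP _ _).1.
exact: inner_continuousl.
Qed.

(** The inner product formula extends from pure tensors by linearity and continuity, in one argument
    after the other. *)
Lemma tens_map : tensor_map (fun x y => tens D x y).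
Proof.
split; last first.
  move=> O O0 oO; have [x [Ox [n [c [e [He xE]]]]]] := @dense_pure _ _ _ V D O O0 oO.
  exists x; split=> //; exists n, c, e; split=> // j.
  by have [z _ <-] := He j; exists (pure V B z, pure V C z); rewrite //= tens_pure.
have step1 x y x' z : inner (tens D x' (pure V C z)) (tens D x y) =
    inner x' x * inner (pure V C z) y.
  apply/eqP; rewrite -subr_eq0; apply/eqP.
  apply: (linear_dense0 (h := fun x' => inner (tens D x' (pure V C z)) (tens D x y) -
    inner x' x * inner (pure V C z) y) (@dense_pure _ _ _ V B)).
  - move=> u; apply: cvgB; first exact: continuousl.
    by apply: cvgM; [exact: inner_continuousl|exact: cvg_cst].
  - by move=> c u v; rewrite tens_linl !innerDl !innerZl; ring.
  move=> z'; rewrite -(pure_mixl B z' z) -(pure_mixr z' z sp.1) tens_pure.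
  by rewrite innerC tensE !(innerC x) !(innerC y) subrr.
move=> x y x' y'; rewrite innerC (innerC x) (innerC y).
apply/eqP; rewrite -subr_eq0; apply/eqP.
apply: (linear_dense0 (h := fun y' => inner (tens D x' y') (tens D x y) -
  inner x' x * inner y' y) (@dense_pure _ _ _ V C)).
- move=> u; apply: cvgB; first exact: continuousr.
  by apply: cvgM; [exact: cvg_cst|exact: inner_continuousl].
- by move=> c u v; rewrite tens_linr !innerDl !innerZl; ring.
by move=> z; rewrite step1 subrr.
Qed.

End TensTheory.

Lemma tensC B C D (sp : splits B C D) (x : V B) (y : V C) : tens D x y = tens D y x.
Proof. by apply: eq_pure => z; rewrite !tensE //; [rewrite mulrC|exact: splitsC]. Qed.

Lemma tensA B C A A' B' D (x : V B) (y : V C) (z : V A') :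
  splits B C A -> splits A A' D -> splits C A' B' -> splits B B' D ->
  tens D x (tens B' y z) = tens D (tens A x y) z.
Proof. by move=> s1 s2 s3 s4; apply: eq_pure => q; rewrite !tensE // mulrA. Qed.

Lemma slice_tens B C A A' B' D (s1 : splits B C A) (s2 : splits A A' D)
    (s3 : splits C A' B') (s4 : splits B B' D) (x : V A) (y : V A') (b : V B) :
  slice (tmap_flip (tens_map s4)) (tens D x y) b =
  tens B' (slice (tmap_flip (tens_map s1)) x b) y.
Proof.
apply: eq_pure => z; rewrite sliceE tensE // sliceE -(tens_pure s3).
by rewrite (tensA _ _ _ s1 s2 s3 s4) (tens_map s2).1.
Qed.

(** An operator on a part B of A turns each term into an elementary tensor with the same factor
    [y j] over A', so the number of terms does not grow. *)
Lemma elem_rank_slice B C A A' B' D (s1 : splits B C A) (s2 : splits A A' D)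
    (s3 : splits C A' B') (s4 : splits B B' D) m (w : V D) k
    (g : 'I_k -> R) (b : 'I_k -> V B) :
  elem_rank (T := fun x y => @tens A A' D x y) m w ->
  elem_rank (T := fun x y => @tens A A' D x y) m
    (\sum_i g i *: tens D (b i) (slice (tmap_flip (tens_map s4)) w (b i))).
Proof.
move=> [x [y ->]].
exists (fun j => \sum_i g i *: tens A (b i) (slice (tmap_flip (tens_map s1)) (x j) (b i))), y.
transitivity (\sum_i \sum_(j < m) g i *: tens D (b i)
    (slice (tmap_flip (tens_map s4)) (tens D (x j) (y j)) (b i))).
  apply: eq_bigr => i _; rewrite slice_suml -scaler_sumr; congr (_ *: _).
  exact: (tmap_suml (tmap_flip (tens_map s4))).
rewrite exchange_big; apply: eq_bigr => j _ /=.
rewrite (tmap_suml (tens_map s2)); apply: eq_bigr => i _.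
by rewrite (tmapZl (tens_map s2)) (slice_tens s1 s2 s3 s4) (tensA _ _ _ s1 s2 s3 s4).
Qed.

End TensorProducts.

Section Counting.
Context {R : realType}.

Lemma counting_le (X : set nat) m : X `<=` `I_m -> (counting X <= m%:R%:E :> \bar R)%E.
Proof.
move=> Xm; have finX := sub_finite_set Xm (finite_II m).
rewrite /counting asboolT // lee_fin ler_nat.
have /fsubset_leq_card : (fset_set X `<=` fset_set `I_m)%fset.
  by rewrite -fset_set_sub //; exact: finite_II.
by rewrite fset_set_II card_imfset // /= size_enum_ord.
Qed.

Lemma counting_ge (X : set nat) m : `I_m `<=` X -> (m%:R%:E <= counting X :> \bar R)%E.
Proof.
move=> mX; rewrite /counting; case: asboolP => [finX|_]; last exact: leey.
rewrite lee_fin ler_nat.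
have /fsubset_leq_card : (fset_set `I_m `<=` fset_set X)%fset.
  by rewrite -fset_set_sub //; exact: finite_II.
by rewrite fset_set_II card_imfset // /= size_enum_ord.
Qed.

End Counting.

(** * Matricizations, and ranks under thresholding at other edges *)

Section Matricization.
Context {R : realType} {d : nat} {H : 'I_d -> hilbert R}.
Variable V : tensor_space H.
Implicit Types (A B N : {set 'I_d}).
Local Notation full := [set: 'I_d]%SET.

Lemma splits_compl A : splits A (~: A)%SET full.
Proof. by split; [rewrite -setI_eq0 finset.setICr|rewrite finset.setUCr]. Qed.

Lemma splits_diff A B : (A \subset B)%B -> splits A (B :\: A)%SET B.
Proof.
move=> AB; split; first by rewrite -setI_eq0 finset.setIDA finset.setDIl finset.setDv finset.set0I.
by rewrite -{2}(finset.setID B A) (finset.setIidPr AB).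
Qed.

Lemma splits_compl_diff A B : (A \subset B)%B -> splits (B :\: A)%SET (~: B)%SET (~: A)%SET.
Proof.
move=> AB; split.
  by rewrite -setI_eq0; apply/eqP/setP => i; rewrite !inE; case: (i \in B); rewrite ?andbF.
apply/setP => i; rewrite !inE; have := fintype.subsetP AB i.
by case: (i \in A) => [/(_ isT) ->|] //; case: (i \in B).
Qed.

Definition edge_map A := tens_map V (splits_compl A).

(** Continuity and the density of the span of pure tensors make the operator unique, so the one
    chosen in [matricization] is the contraction. *)
Lemma matricization_slice A (u : V full) :
  matricization (A := A) u = slice (edge_map A) u.
Proof.
have ismat : is_matricization (A := A) u (slice (edge_map A) u).
  split=> [|z]; first exact: slice_hilbert_schmidt.
  by rewrite sliceE tens_pure //; exact: splits_compl.
suff uniq X : is_matricization (A := A) u X -> X = slice (edge_map A) u.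
  by apply: uniq; apply: xgetPex; exists (slice (edge_map A) u).
move=> [[Xl Xc _] Xz]; apply/funext => y; apply: eq_pure => z.
apply/eqP; rewrite -subr_eq0; apply/eqP.
apply: (linear_dense0 (h := fun y => inner (X y) (pure V A z) -
  inner (slice (edge_map A) u y) (pure V A z)) (@dense_pure _ _ _ V (~: A)%SET)).
- move=> x; apply: cvgB; apply: cvg_inner; first exact: Xc.
  exact: slice_continuous.
- by move=> c x x'; rewrite Xl slice_linear !innerDl !innerZl; ring.
move=> z'; have dA : [disjoint A & (~: A)%SET]%B by case: (splits_compl A).
rewrite -(pure_mixl V A z z') -(pure_mixr V z z' dA) Xz sliceE tens_pure ?subrr //.
exact: splits_compl.
Qed.

Lemma soft_thr_at_sthr A al (u : V full) :
  soft_thr_at A al u = sthr (edge_map A) al u.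
Proof.
rewrite /soft_thr_at /matricization_inv /sthr matricization_slice.
by congr xget; apply/funext => v /=; rewrite matricization_slice.
Qed.

Lemma tensor_sv_slice A (u : V full) :
  tensor_sv A u = singular_values (slice (edge_map A) u).
Proof. by rewrite /tensor_sv matricization_slice. Qed.

Definition erank A m (u : V full) :=
  elem_rank (T := fun (x : V A) (y : V (~: A)%SET) => tens full x y) m u.

Lemma tensor_sv_schmidt A (u : V full) : exists b a,
  schmidt_decomp (T := fun (x : V A) (y : V (~: A)%SET) => tens full x y) u (tensor_sv A u) a b.
Proof.
have [s [b [a [svdE sch]]]] := svd_slice (edge_map A) u.
by exists b, a; rewrite tensor_sv_slice /singular_values svdE.
Qed.

Lemma tensor_rank_le A m (u : V full) : erank A m u -> (tensor_rank A u <= m%:R%:E)%E.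
Proof.
move=> um; have [b [a sch]] := tensor_sv_schmidt A u.
have [[s0 sdec] _ _ _] := sch.
have sm := elem_rank_sv (edge_map A) sch um.
apply: counting_le => k /=; apply: contraNT; rewrite -leqNgt => mk.
by rewrite eq_le s0 -sm sdec.
Qed.

Lemma erankC A B m (u : V full) : splits A B full ->
  elem_rank (T := fun (x : V A) (y : V B) => tens full x y) m u ->
  elem_rank (T := fun (x : V B) (y : V A) => tens full x y) m u.
Proof.
move=> sp [x [y ->]]; exists y, x; apply: eq_bigr => j _; exact: tensC.
Qed.

(** For N inside A, thresholding acts on a part of A; for N disjoint from A, on a part of the
    complement of A. For A inside N, the complement of N lies inside that of A, so the form acting
    on the second factor is used. *)
Lemma erank_soft_thr A N (al : R) m (u : V full) : 0 < al ->
  [|| N \subset A, A \subset N | [disjoint A & N]]%B ->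
  erank A m u -> erank A m (soft_thr_at N al u).
Proof.
move=> al0 + um; rewrite soft_thr_at_sthr.
have sA := splits_compl A; have sN := splits_compl N.
case/or3P => [NA|AN|AN].
- have [k [g [b ->]]] := sthr_slice_l (edge_map N) u al0.
  exact: (elem_rank_slice (splits_diff NA) sA (splits_compl_diff NA) (splits_compl N)).
- have [k [g [b ->]]] := sthr_slice_r (edge_map N) u al0.
  have NA : (~: N \subset ~: A)%SET by rewrite finset.setCS.
  apply: (erankC (splitsC sA)).
  have s3 : splits (~: A :\: ~: N)%SET A N.
    by have := splits_compl_diff NA; rewrite !finset.setCK.
  have := elem_rank_slice (splits_diff NA) (splitsC sA) s3 (splitsC sN) g b (erankC sA um).
  congr elem_rank; apply: eq_bigr => i _; congr (_ *: _).
  rewrite (tensC (splitsC sN)); congr tens.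
  by apply: inner_ext => z; rewrite !sliceE (tensC sN).
- have NA : (N \subset ~: A)%SET by rewrite -finset.disjoints_subset disjoint_sym.
  have [k [g [b ->]]] := sthr_slice_l (edge_map N) u al0.
  apply: (erankC (splitsC sA)).
  have s3 : splits (~: A :\: N)%SET A (~: N)%SET.
    by have := splits_compl_diff NA; rewrite !finset.setCK.
  exact: (elem_rank_slice (splits_diff NA) (splitsC sA) s3 (splits_compl N) _ _ (erankC sA um)).
Qed.

End Matricization.

(** Induction on the size of a node r containing both. If both are proper in r, each lies in a child
    of r: either in the same one, which is smaller, or in different ones, which are disjoint. *)
Lemma tree_laminar d (T : {set {set 'I_d}}) (A N : {set 'I_d}) : dimension_tree T ->
  A \in T -> N \in T -> [|| N \subset A, A \subset N | [disjoint A & N]]%B.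
Proof.
case=> T0 TT Tc.
suff H k : forall r A N : {set 'I_d}, (#|r| <= k)%N -> r \in T -> A \in T -> N \in T ->
    (A \subset r)%B -> (N \subset r)%B -> [|| N \subset A, A \subset N | [disjoint A & N]]%B.
  by move=> AT NT; apply: (H _ _ A N (leqnn _) TT); rewrite ?finset.subsetT.
elim: k => [|k IH] r {}A {}N rk rT AT NT Ar Nr.
  by move: rk; rewrite leqn0 cards_eq0 => /eqP r0; rewrite -r0 rT in T0.
have [->|/eqP Aner] := eqVneq A r; first by rewrite Nr.
have [->|/eqP Nner] := eqVneq N r; first by rewrite Ar orbT.
have Apr : (A \proper r)%B by rewrite finset.properEneq Ar andbT; apply/eqP.
have Npr : (N \proper r)%B by rewrite finset.properEneq Nr andbT; apply/eqP.
have A0 : (0 < #|A|)%N by rewrite card_gt0; apply: contraNneq T0 => <-.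
have r2 : (2 <= #|r|)%N by rewrite (leq_ltn_trans A0) // proper_card.
have [_ /and3P[_ /finset.trivIsetP tI _]] := Tc _ rT r2.
pose P m' := (m' \in T) && (m' \proper r)%B.
have [c cmax Ac] : {c | maxset P c & (A \subset c)%B} by apply: maxset_exists; rewrite /P AT.
have [e emax Ne] : {c | maxset P c & (N \subset c)%B} by apply: maxset_exists; rewrite /P NT.
have [ce|/eqP ce] := eqVneq c e.
  have /andP[cT cr] := maxsetp cmax.
  apply: (IH c) => //; last by rewrite ce.
  by rewrite -ltnS (leq_trans (proper_card cr)).
have dce : [disjoint c & e]%B by apply: tI; rewrite ?inE //; apply/eqP.
by rewrite (disjointWl Ac) ?orbT // (disjointWr Ne).
Qed.

(** * Truncated sums of squares *)

Section Numerics.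
Context {R : realType}.

Lemma sumr_const0 (x : R) k : \sum_(0 <= i < k) x = k%:R * x.
Proof. by rewrite sumr_const_nat subn0 mulr_natl. Qed.

(* Halving the truncation level x costs at most x^2 per index above x / 2. *)
Lemma dyadic_sum (s : nat -> R) (phi : R -> R) (al Psi : R) : 0 < al ->
  (forall i, 0 <= s i) -> (forall x, 0 < x -> 0 <= phi x) ->
  (forall n x, 0 < x -> x < s n -> n.+1%:R <= phi x) ->
  (forall m, \sum_(0 <= j < m) phi (al / 2 ^+ j.+1) / 4 ^+ j <= Psi) ->
  forall n, \sum_(0 <= i < n) Num.min (s i) al ^+ 2 <= al ^+ 2 * Psi.
Proof.
move=> al0 s0 phi0 sphi Hpsi n; have e4 : 2 ^+ 2 = 4 :> R by rewrite -natrX.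
pose r x := \sum_(0 <= i < n) Num.min (s i) x ^+ 2.
have step x : 0 < x -> r x <= x ^+ 2 * phi (x / 2) + r (x / 2).
  move=> x0; have x20 : 0 < x / 2 by rewrite divr_gt0.
  have cnt m : \sum_(0 <= i < m) (x / 2 < s i)%R%:R <= phi (x / 2).
    elim: m => [|m IH]; first by rewrite big_geq // phi0.
    rewrite big_nat_recr //=; case: (ltP (x / 2) (s m)) => [xm|_]; last by rewrite addr0.
    apply: le_trans (sphi m _ x20 xm); rewrite -[leRHS]natr1 lerD2r.
    rewrite -[leRHS]mulr1 -sumr_const0.
    by apply: ler_sum => i _; rewrite lern1 leq_b1.
  apply: (@le_trans _ _ (\sum_(0 <= i < n)
      (x ^+ 2 * (x / 2 < s i)%R%:R + Num.min (s i) (x / 2) ^+ 2))).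
    apply: ler_sum => i _; have := s0 i.
    case: (ltP (x / 2) (s i)) => h si.
      rewrite mulr1 (@le_trans _ _ (x ^+ 2)) ?lerDl ?sqr_ge0 //.
      by rewrite ler_sqr ?nnegrE ?ge_min ?lexx ?orbT ?le_min ?si ?(ltW x0).
    by rewrite mulr0 add0r !min_l // (le_trans h) // ler_pdivrMr // ler_peMr ?(ltW x0) // ler1n.
  by rewrite big_split -mulr_sumr lerD2r ler_wpM2l ?sqr_ge0.
have iter m : r al <= al ^+ 2 * (\sum_(0 <= j < m) phi (al / 2 ^+ j.+1) / 4 ^+ j) +
    r (al / 2 ^+ m).
  elim: m => [|m IH]; first by rewrite big_geq // mulr0 add0r expr0 divr1.
  apply: le_trans IH _; rewrite big_nat_recr //= mulrDr -addrA lerD2l.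
  have xm : 0 < al / 2 ^+ m by rewrite divr_gt0 ?exprn_gt0.
  apply: le_trans (step _ xm) _; rewrite le_eqVlt; apply/orP; left; apply/eqP.
  have -> : al / 2 ^+ m / 2 = al / 2 ^+ m.+1 by rewrite exprSr invfM mulrA.
  congr (_ + _); rewrite exprMn exprVn -exprM mulnC exprM e4.
  by rewrite -mulrA (mulrC _ (phi _)).
(* For fixed n, the part left after m halvings is at most n (al / 2^m)^2 and vanishes as m grows. *)
have rle x : 0 < x -> r x <= n%:R * x ^+ 2.
  move=> x0; rewrite -sumr_const0.
  apply: ler_sum => i _.
  by rewrite ler_sqr ?nnegrE ?le_min ?ge_min ?lexx ?orbT ?s0 ?(ltW x0).
have lim0 : (fun m => al ^+ 2 * Psi + n%:R * al ^+ 2 * (4^-1) ^+ m) @ \oo -->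
    al ^+ 2 * Psi + n%:R * al ^+ 2 * 0.
  apply: cvgD; first exact: cvg_cst.
  apply: cvgM; first exact: cvg_cst.
  by apply: cvg_expr; rewrite ger0_norm ?invr_ge0 // invf_lt1 // ltr1n.
rewrite -[leRHS]addr0 -[X in _ <= _ + X](mulr0 (n%:R * al ^+ 2)).
apply: (ler_cvg_filter _ (cvg_cst (r al)) lim0) => m.
apply: le_trans (iter m) _; apply: lerD; first by rewrite ler_wpM2l ?sqr_ge0.
have xm : 0 < al / 2 ^+ m by rewrite divr_gt0 ?exprn_gt0.
apply: le_trans (rle _ xm) _; rewrite -mulrA ler_wpM2l //.
by rewrite exprMn !exprVn -exprM mulnC exprM e4.
Qed.

Lemma geometric_bound (z : R) m : 0 <= z < 1 -> \sum_(0 <= j < m) z ^+ j <= (1 - z)^-1.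
Proof.
move=> /andP[z0 z1]; have z10 : 0 < 1 - z by rewrite subr_gt0.
rewrite -[leRHS]mul1r ler_pdivlMr // mulrC big_mkord -opprB mulNr -subrX1 opprB.
by rewrite gerBl exprn_ge0.
Qed.

(** The first n + 1 entries exceed x, so x is at most the (n+1)-th largest one, and the weak norm
    bounds (n+1)^(1/p) x by M. *)
Lemma weak_lp_count (p M : R) (s : nat -> R) : 0 < p -> (forall i, 0 <= s i) ->
  (forall i j, (i <= j)%N -> s j <= s i) -> weak_lp p s ->
  fine (weak_lp_norm p s) <= M ->
  forall n x, 0 < x -> x < s n -> n.+1%:R <= (M / x) `^ p.
Proof.
move=> p0 s0 sdec fin normM n x x0 xs.
have xr : (x%:E <= rearrangement s n)%E.
  apply: le_ereal_inf_tmp => _ [l [l0 cl] <-]; rewrite lee_fin leNgt; apply/negP => lx.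
  have : (n.+1%:R%:E <= n%:R%:E :> \bar R)%E.
    apply: le_trans cl; apply: counting_ge => k /=; rewrite ltnS => kn.
    by rewrite ger0_norm // (lt_le_trans (lt_trans lx xs)) // sdec.
  by rewrite lee_fin ler_nat ltnn.
have np : 0 < n.+1%:R `^ p^-1 :> R by rewrite powR_gt0.
have : ((n.+1%:R `^ p^-1 * x)%:E <= weak_lp_norm p s)%E.
  apply: (@le_trans _ _ ((n.+1%:R `^ p^-1)%:E * rearrangement s n)%E).
    by rewrite EFinM lee_pmul2l.
  by apply: ereal_sup_ubound; exists n.
move: fin normM; rewrite /weak_lp /=; case: (weak_lp_norm p s) => [r|//|//] _ /= rM.
rewrite lee_fin => nr.
have : n.+1%:R `^ p^-1 <= M / x by rewrite ler_pdivlMr // (le_trans nr).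
move=> /(ge0_ler_powR (ltW p0)).
rewrite !nnegrE -powRrM mulVf ?gt_eqF // powRr1 //; apply; first exact: ltW.
by rewrite divr_ge0 ?(ltW x0) // (le_trans _ rM) // (le_trans _ nr) // mulr_ge0 ?(ltW np) ?(ltW x0).
Qed.

(** The logarithm is nonpositive for x >= C, where no [s n] exceeds x; the maximum with 0 makes the
    bound vanish there. *)
Lemma exp_count (C c beta : R) (s : nat -> R) : 0 < C -> 0 < c -> 0 < beta ->
  (forall k, s k <= C * expR (- c * k.+1%:R `^ beta)) ->
  forall n x, 0 < x -> x < s n -> n.+1%:R <= (Num.max 0 (ln (C / x)) / c) `^ beta^-1.
Proof.
move=> C0 c0 b0 sC n x x0 xs.
have : x < C * expR (- c * n.+1%:R `^ beta) by exact: lt_le_trans (sC n).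
rewrite mulNr expRN ltr_pdivlMr ?expR_gt0 // mulrC -ltr_pdivlMr // => H.
have : c * n.+1%:R `^ beta <= ln (C / x).
  by rewrite -ler_expR lnK ?posrE ?divr_gt0 // ltW.
rewrite mulrC -ler_pdivlMr // => H2.
have : n.+1%:R `^ beta <= Num.max 0 (ln (C / x)) / c.
  by apply: le_trans H2 _; rewrite ler_pM2r ?invr_gt0 // le_max lexx orbT.
have b0' : 0 <= beta^-1 by rewrite invr_ge0 ltW.
move=> /(ge0_ler_powR b0'); rewrite !nnegrE -powRrM mulfV ?gt_eqF // powRr1 //; apply.
  by rewrite powR_ge0.
by rewrite divr_ge0 ?(ltW c0) // le_max lexx.
Qed.

(* (m / A)^g = exp (g ln (m / A)) <= exp (g m / A) = 2^m for A = g / ln 2 *)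
Lemma powR_le_exp2 (g : R) : 0 < g -> exists2 K, 0 < K &
  forall m : nat, m.+1%:R `^ g <= K * 2 ^+ m.
Proof.
move=> g0; have l2 : 0 < ln 2 :> R by rewrite ln_gt0 // ltr1n.
have A0 : 0 < g / ln 2 by rewrite divr_gt0.
exists (2 * (g / ln 2) `^ g) => [|m]; first by rewrite mulr_gt0 // powR_gt0.
set A := g / ln 2 in A0 *.
have -> : m.+1%:R = A * (m.+1%:R / A) :> R by rewrite mulrC mulfVK // gt_eqF.
have mA : 0 < m.+1%:R / A :> R by rewrite divr_gt0.
rewrite powRM ?(ltW A0) ?(ltW mA) // [2 * _]mulrC -mulrA ler_wpM2l ?powR_ge0 // -exprS.
rewrite /powR gt_eqF // -[leRHS]lnK ?posrE ?exprn_gt0 // ler_expR lnXn //.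
have -> : ln 2 *+ m.+1 = g * (m.+1%:R / A).
  rewrite -[_ *+ m.+1]mulr_natl /A; set x := m.+1%:R; field.
  by rewrite (gt_eqF g0) (gt_eqF l2).
rewrite ler_pM2l //; move: (m.+1%:R / A) mA => y y0.
have /le_ln1Dx : -1 < y - 1 by lra.
by rewrite (_ : 1 + (y - 1) = y); [lra|ring].
Qed.

End Numerics.

(** * The iteration *)

Section Iteration.
Context {R : realType} {d : nat} {H : 'I_d -> hilbert R}.
Variable V : tensor_space H.
Local Notation full := [set: 'I_d]%SET.
Implicit Types (A : {set 'I_d}) (u v w : V full).

(** Singular values being non-increasing, at most [phi x] of them exceed x. *)
Definition sv_bound (phi : R -> R) A w :=
  forall n x, 0 < x -> x < tensor_sv A w n -> n.+1%:R <= phi x.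

Lemma tensor_sv_props A w : (forall i, 0 <= tensor_sv A w i) /\
  (forall i j, (i <= j)%N -> tensor_sv A w j <= tensor_sv A w i).
Proof. by have [b [a [[]]]] := tensor_sv_schmidt A w. Qed.

Lemma soft_thr_at_nonexpansive A (al : R) v w : 0 < al ->
  `|soft_thr_at A al v - soft_thr_at A al w| <= `|v - w|.
Proof. by move=> al0; rewrite !soft_thr_at_sthr; exact: sthr_nonexpansive. Qed.

Lemma soft_thr_at_dist A (al Psi : R) phi w : 0 < al ->
  (forall x, 0 < x -> 0 <= phi x) -> sv_bound phi A w ->
  (forall m, \sum_(0 <= j < m) phi (al / 2 ^+ j.+1) / 4 ^+ j <= Psi) ->
  `|w - soft_thr_at A al w| ^+ 2 <= al ^+ 2 * Psi.
Proof.
move=> al0 phi0 wphi HPsi; rewrite soft_thr_at_sthr; apply: sthr_dist => //.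
rewrite -tensor_sv_slice; apply: (dyadic_sum al0 _ phi0) => //.
exact: (tensor_sv_props A w).1.
Qed.

Lemma soft_thr_at_eq0 A (al : R) phi w : 0 < al -> sv_bound phi A w -> phi al < 1 ->
  soft_thr_at A al w = 0.
Proof.
move=> al0 wphi phi1; rewrite soft_thr_at_sthr; apply: sthr0 => //.
rewrite -tensor_sv_slice leNgt; apply/negP => /(wphi _ _ al0).
by rewrite leNgt phi1.
Qed.

Lemma soft_thr_at_erank A (al : R) phi u v : 0 < al ->
  (forall x, 0 < x -> 0 <= phi x) -> sv_bound phi A u ->
  exists2 m : nat, erank A m (soft_thr_at A al v) &
    m%:R <= 2 * phi (al / 2) + 4 * (`|v - u| / al) ^+ 2.
Proof.
move=> al0 phi0 uphi; have a20 : 0 < al / 2 by rewrite divr_gt0.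
have [b [a sch]] := tensor_sv_schmidt A u.
have [N HN] := sv_count (edge_map V A) sch a20.
have [|m mr mle] := @sthr_elem_rank _ _ _ _ _ (edge_map V A) al u v N al0.
  by rewrite -tensor_sv_slice leNgt -HN ltnn.
exists m; first by rewrite soft_thr_at_sthr.
apply: le_trans mle _; rewrite lerD2r ler_pM2l //.
case: N HN => [|N] HN; first exact: phi0.
by apply: (uphi N) => //; rewrite -HN.
Qed.

Lemma erank0 A m : erank A m (0 : V full).
Proof.
exists (fun=> 0), (fun=> 0); rewrite big1 // => j _.
exact: (tmap0l (edge_map V A)).
Qed.

Variables (E : nat) (n_ : 'I_E -> {set 'I_d}) (T : {set {set 'I_d}}).
Hypotheses (treeT : dimension_tree T) (nT : forall t, n_ t \in T).

Let S (al : R) (v : V full) (s : seq 'I_E) := foldl (fun v t => soft_thr_at (n_ t) al v) v s.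

(** Each step is nonexpansive and moves u by at most eta. The list is arbitrary because the rank
    estimate at an edge concerns only the edges before it. *)
Lemma foldl_dist (al eta : R) u v s : 0 < al ->
  (forall t, `|u - soft_thr_at (n_ t) al u| <= eta) ->
  `|S al v s - u| <= `|v - u| + (size s)%:R * eta.
Proof.
move=> al0 ueta; elim: s v => [|t s IH] v /=; first by rewrite mul0r addr0.
apply: le_trans (IH _) _; rewrite -natr1 mulrDl mul1r [_ * eta + eta]addrC addrA lerD2r.
set w := soft_thr_at (n_ t) al v.
apply: (@le_trans _ _ (`|w - soft_thr_at (n_ t) al u| + `|soft_thr_at (n_ t) al u - u|)).
  by rewrite -{1}(subrK (soft_thr_at (n_ t) al u) w) -addrA ler_normD.
by rewrite lerD ?soft_thr_at_nonexpansive // distrC.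
Qed.

Lemma foldl_erank (al : R) t m v s : 0 < al -> erank (n_ t) m v -> erank (n_ t) m (S al v s).
Proof.
move=> al0; elim: s v => //= t' s IH v vm; apply: IH.
by apply: erank_soft_thr => //; exact: tree_laminar treeT _ _.
Qed.

Lemma soft_thr_all_erank (al eta x : R) phi u v t : 0 < al -> 0 <= eta ->
  (forall t, `|u - soft_thr_at (n_ t) al u| <= eta) ->
  (forall y, 0 < y -> 0 <= phi y) -> sv_bound phi (n_ t) u ->
  `|v - u| + E%:R * eta <= x ->
  exists2 m : nat, erank (n_ t) m (soft_thr_all n_ al v) &
    m%:R <= 2 * phi (al / 2) + 4 * (x / al) ^+ 2.
Proof.
move=> al0 eta0 ueta phi0 uphi vx.
have tE : t \in enum 'I_E by rewrite mem_enum.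
have sE : size (enum 'I_E) = E by rewrite size_enum_ord.
(* The edges before t increase the distance to u in a controlled way, edge t produces the rank
   bound, and the edges after t preserve it. *)
rewrite /soft_thr_all; case/splitPr: tE sE => s1 s2 sE.
rewrite foldl_cat /=; set v1 := foldl _ v s1.
have [m mr mle] := soft_thr_at_erank v1 al0 phi0 uphi.
exists m; first exact: foldl_erank.
apply: le_trans mle _; rewrite lerD2l ler_pM2l // ler_sqr ?nnegrE; last 2 first.
- by rewrite divr_ge0 // ltW.
- rewrite divr_ge0 ?(ltW al0) // (le_trans _ vx) // addr_ge0 // mulr_ge0 //.
rewrite ler_pM2r ?invr_gt0 // (le_trans _ vx) // (le_trans (foldl_dist v s1 al0 ueta)) //.
by rewrite lerD2l ler_wpM2r // ler_nat -[leqRHS]sE size_cat leq_addr.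
Qed.

Variables (F : V full -> V full) (ustar : V full) (rho : R).
Hypotheses (rho0 : 0 <= rho) (Flip : forall v w, `|F v - F w| <= rho * `|v - w|)
  (Fu : F ustar = ustar).

Lemma stii_bound (alpha_ eta x : nat -> R) phi : (forall k, 0 < alpha_ k) ->
  (forall k t, `|ustar - soft_thr_at (n_ t) (alpha_ k) ustar| <= eta k) ->
  (forall k, 0 <= eta k) ->
  `|ustar| <= x 0%N -> (forall k, rho * x k + E%:R * eta k <= x k.+1) ->
  (forall y, 0 < y -> 0 <= phi y) -> (forall t, sv_bound phi (n_ t) ustar) ->
  forall k, `|stii n_ F alpha_ k - ustar| <= x k /\
    forall t, exists2 m : nat, erank (n_ t) m (stii n_ F alpha_ k.+1) &
      m%:R <= 2 * phi (alpha_ k / 2) + 4 * (x k.+1 / alpha_ k) ^+ 2.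
Proof.
move=> al0 ueta eta0 ux xS phi0 uphi k.
have Fx j : `|stii n_ F alpha_ j - ustar| <= x j ->
    `|F (stii n_ F alpha_ j) - ustar| + E%:R * eta j <= x j.+1.
  move=> xj; apply: le_trans (xS j); rewrite lerD2r.
  by rewrite -{1}Fu (le_trans (Flip _ _)) // ler_wpM2l.
have xk : `|stii n_ F alpha_ k - ustar| <= x k.
  elim: k => [|k IH]; first by rewrite sub0r normrN.
  apply: le_trans (Fx _ IH) => /=.
  have := foldl_dist (F (stii n_ F alpha_ k)) (enum 'I_E) (al0 k) (ueta k).
  by rewrite size_enum_ord.
split=> // t; exact: (soft_thr_all_erank (al0 k) (eta0 k) (ueta k) phi0 (uphi t) (Fx _ xk)).
Qed.

End Iteration.

(** * Error recursion with geometric rate *)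

Section Rates.
Context {R : realType}.

(** The constant D = 2 Q rhot / (rhot - rho) solves rho D + 2 Q rhot = rhot D, with 2 d replacing
    the number 2 d - 3 of edges. Monotonicity of [Lam] lets [Lam k.+1] be factored out, and D >= 2 Q
    gives the initial bound. *)
Lemma error_recursion (rho rhot Q : R) (d : nat) (Lam : nat -> R) :
  0 < rho -> rho < rhot -> 0 <= Q -> (1 <= d)%N -> Lam 0%N = 1 ->
  (forall k, 0 <= Lam k) -> (forall k, Lam k <= Lam k.+1) ->
  let x k := 2 * Q * rhot / (rhot - rho) * (d%:R * Lam k * rhot ^+ k) in
  Q <= x 0%N /\
  forall k, rho * x k + (2 * d - 3)%:R * (Q * (Lam k.+1 * rhot ^+ k.+1)) <= x k.+1.
Proof.
move=> rho0 rhot_gt Q0 d1 Lam0 Lamge LamS x.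
have rt0 : 0 < rhot by exact: lt_trans rhot_gt.
have rr : 0 < rhot - rho by rewrite subr_gt0.
have dR : 1 <= d%:R :> R by rewrite ler1n.
set D := 2 * Q * rhot / (rhot - rho) in x *.
have DE : D * (rhot - rho) = 2 * Q * rhot by rewrite /D mulfVK // gt_eqF.
have DQ : 2 * Q <= D by rewrite ler_pdivlMr // ler_wpM2l ?mulr_ge0 // gerBl ltW.
split; first by rewrite /x Lam0 expr0 !mulr1; nra.
move=> k; rewrite /x exprS.
have E0 : (2 * d - 3)%:R <= 2 * d%:R :> R by rewrite -natrM ler_nat leq_subr.
have e0 : 0 <= rhot ^+ k by rewrite exprn_ge0 // ltW.
have L0 := Lamge k.+1; have LS := LamS k.
have D0 : 0 <= D by rewrite (le_trans _ DQ) // mulr_ge0.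
have LD : 0 <= D * d%:R * rhot ^+ k by exact: mulr_ge0 (mulr_ge0 D0 (ler0n _ _)) e0.
have h1 : rho * (D * (d%:R * Lam k * rhot ^+ k)) <=
    rho * (D * d%:R * rhot ^+ k) * Lam k.+1.
  rewrite (_ : rho * (D * _) = rho * (D * d%:R * rhot ^+ k) * Lam k); last by ring.
  by rewrite ler_wpM2l // mulr_ge0 // ltW.
have h2 : (2 * d - 3)%:R * (Q * (Lam k.+1 * (rhot * rhot ^+ k))) <=
    2 * d%:R * (Q * (Lam k.+1 * (rhot * rhot ^+ k))).
  by rewrite ler_wpM2r // !mulr_ge0 // ltW.
apply: le_trans (lerD h1 h2) _; rewrite le_eqVlt; apply/orP; left; apply/eqP.
rewrite [X in _ + X](_ : _ = (2 * Q * rhot) * (d%:R * Lam k.+1 * rhot ^+ k)); last by ring.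
by rewrite -DE; ring.
Qed.

Lemma powR_exprn (a p : R) n : 0 <= a -> (a ^+ n) `^ p = (a `^ p) ^+ n.
Proof.
move=> a0; elim: n => [|n IH]; first by rewrite !expr0 powR1.
by rewrite !exprS powRM ?exprn_ge0 // IH.
Qed.

Lemma bigmaxe_le (I : finType) (f : I -> \bar R) (x : R) : 0 <= x ->
  (forall i, (f i <= x%:E)%E) -> (\big[maxe/0%E]_i f i <= x%:E)%E.
Proof.
move=> x0 fx; elim/big_ind: _ => [|a b ha hb|i _]; [by rewrite lee_fin| |exact: fx].
by rewrite ge_max ha.
Qed.

End Rates.

Section Parts.
Context {R : realType}.
Variables (rho rhot : R).
Hypotheses (hrho : 0 < rho < 1) (hrhot : rho < rhot).

Let rho0 : 0 < rho. Proof. by case/andP: hrho. Qed.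
Let rt0 : 0 < rhot. Proof. exact: lt_trans hrhot. Qed.

(* Both parts at once; [Lam] is the logarithmic factor of the second one. *)
Lemma stii_rates (phi Psi : R -> R) (al0 Q : R) (alpha_ Lam : nat -> R)
    (d : nat) (H : 'I_d -> hilbert R) (V : tensor_space H)
    (T : {set {set 'I_d}}) (n_ : 'I_(2 * d - 3) -> {set 'I_d})
    (F : V [set: 'I_d]%SET -> V [set: 'I_d]%SET) (ustar : V [set: 'I_d]%SET) :
  (2 <= d)%N -> dimension_tree T -> edge_enumeration T n_ ->
  (forall v w, `|F v - F w| <= rho * `|v - w|) -> F ustar = ustar ->
  (forall y, 0 < y -> 0 <= phi y) -> (forall t, sv_bound phi (n_ t) ustar) ->
  (forall al m, 0 < al -> \sum_(0 <= j < m) phi (al / 2 ^+ j.+1) / 4 ^+ j <= Psi al) ->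
  0 < al0 -> phi al0 < 1 -> 0 <= Q -> al0 ^+ 2 * Psi al0 <= Q ^+ 2 ->
  (forall k, 0 < alpha_ k) ->
  Lam 0%N = 1 -> (forall k, 0 <= Lam k) -> (forall k, Lam k <= Lam k.+1) ->
  (forall k, alpha_ k ^+ 2 * Psi (alpha_ k) <= (Q * (Lam k.+1 * rhot ^+ k.+1)) ^+ 2) ->
  let D := 2 * Q * rhot / (rhot - rho) in
  let x k := D * (d%:R * Lam k * rhot ^+ k) in
  forall k, `|stii n_ F alpha_ k - ustar| <= x k /\
    (\big[maxe/0]_(t < 2 * d - 3) tensor_rank (n_ t) (stii n_ F alpha_ k) <=
      (if k is k'.+1 then 2 * phi (alpha_ k' / 2) + 4 * (x k / alpha_ k') ^+ 2 else 0)%:E)%E.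
Proof.
move=> d2 treeT [nT _ _] Flip Fu phi0 uphi HPsi al00 phi1 Q0 HQ al_gt Lam0 Lamge LamS alQ D x.
have nT' t : n_ t \in T by have := nT t; rewrite !inE => /andP[].
have [xQ xS] := error_recursion rho0 hrhot Q0 (ltnW d2) Lam0 Lamge LamS.
have Etge : (0 < 2 * d - 3)%N by rewrite subn_gt0 (leq_trans _ (leq_mul (leqnn 2) d2)).
have uQ : `|ustar| <= Q.
  rewrite -ler_sqr ?nnegrE //; apply: le_trans HQ; pose t := Ordinal Etge.
  have := soft_thr_at_dist al00 phi0 (uphi t) (fun m => HPsi al0 m al00).
  by rewrite (soft_thr_at_eq0 al00 (uphi t) phi1) subr0.
have eta0 k : 0 <= Q * (Lam k.+1 * rhot ^+ k.+1).
  by rewrite !mulr_ge0 // exprn_ge0 // ltW.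
have ueta k t : `|ustar - soft_thr_at (n_ t) (alpha_ k) ustar| <=
    Q * (Lam k.+1 * rhot ^+ k.+1).
  rewrite -ler_sqr ?nnegrE //; apply: le_trans (alQ k).
  exact: (soft_thr_at_dist (al_gt k) phi0 (uphi t) (fun m => HPsi _ m (al_gt k))).
have bnd := stii_bound treeT nT' (ltW rho0) Flip Fu al_gt ueta eta0 (le_trans uQ xQ) xS phi0 uphi.
move=> k; split; first exact: (bnd k).1.
case: k => [|k].
  by apply: bigmaxe_le => // t; apply: (tensor_rank_le (m := 0)); exact: erank0.
apply: bigmaxe_le => [|t].
  by rewrite addr_ge0 // mulr_ge0 ?sqr_ge0 // phi0 // divr_gt0.
have [m mr mle] := (bnd k).2 t.
by apply: le_trans (tensor_rank_le mr) _; rewrite lee_fin.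
Qed.

End Parts.

(** * Part (i): singular values in a weak sequence space *)

Section Algebraic.
Context {R : realType}.
Variables (rho rhot c0 : R).
Hypotheses (hrho : 0 < rho < 1) (hrhot : rho < rhot) (hc0 : 0 < c0).

Let rho0 : 0 < rho. Proof. by case/andP: hrho. Qed.
Let rt0 : 0 < rhot. Proof. exact: lt_trans hrhot. Qed.
Let rr0 : 0 < rhot - rho. Proof. by rewrite subr_gt0. Qed.

Definition algebraic_bound (p M K : R) : Prop :=
  forall (d : nat) (H : 'I_d -> hilbert R) (V : tensor_space H)
    (T : {set {set 'I_d}}) (n_ : 'I_(2 * d - 3) -> {set 'I_d})
    (F : V [set: 'I_d]%SET -> V [set: 'I_d]%SET) (ustar : V [set: 'I_d]%SET),
  (2 <= d)%N -> dimension_tree T -> edge_enumeration T n_ ->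
  (forall v w, `|F v - F w| <= rho * `|v - w|) -> F ustar = ustar ->
  (forall t, weak_lp p (tensor_sv (n_ t) ustar)) ->
  (forall t, fine (weak_lp_norm p (tensor_sv (n_ t) ustar)) <= M) ->
  let u := stii n_ F (fun k => (rhot ^+ k.+1 * c0) `^ (2 / (2 - p))) in
  forall k, `|u k - ustar| <= K * (d%:R * rhot ^+ k) /\
    (\big[maxe/0]_(t < 2 * d - 3) tensor_rank (n_ t) (u k)
       <= (K * (d%:R ^+ 2 * (rhot ^+ k) `^ (- (p^-1 - 2^-1)^-1)))%:E)%E.

Lemma algebraic_rates (p M : R) : 0 < p < 2 -> 0 <= M ->
  exists2 K, 0 < K & algebraic_bound p M K.
Proof.
move=> /andP[p0 p2] M0.
have p20 : 0 < 2 - p by rewrite subr_gt0.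
pose phi (y : R) := (M / y) `^ p.
(* The ratio of the dyadic series: each halving of the level multiplies [phi] by 2^p and the weight
   by 1 / 4, so it is below 1 for p < 2. *)
pose z : R := 2 `^ p / 4.
have z01 : 0 <= z < 1.
  rewrite divr_ge0 ?powR_ge0 //= ltr_pdivrMr // mul1r.
  have -> : 4 = 2 `^ 2 :> R by rewrite -[X in _ `^ X]/(2%:R) powR_mulrn // -natrX.
  by rewrite /powR pnatr_eq0 /= ltr_expR ltr_pM2r // ln_gt0 // ltr1n.
pose G : R := 2 `^ p * (1 - z)^-1.
have G0 : 0 <= G by case/andP: z01 => z0 z1; rewrite mulr_ge0 ?powR_ge0 // invr_ge0 subr_ge0 ltW.
pose Psi (al : R) := (M / al) `^ p * G.
have phi0 y : 0 < y -> 0 <= phi y by rewrite powR_ge0.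
have HPsi al m : 0 < al -> \sum_(0 <= j < m) phi (al / 2 ^+ j.+1) / 4 ^+ j <= Psi al.
  move=> al0; have Mal : 0 <= M / al by rewrite divr_ge0 // ltW.
  apply: (@le_trans _ _ (\sum_(0 <= j < m) (M / al) `^ p * 2 `^ p * z ^+ j)); last first.
    rewrite -mulr_sumr /Psi /G mulrA ler_wpM2l ?mulr_ge0 ?powR_ge0 //.
    exact: geometric_bound.
  apply: ler_sum => j _; rewrite /phi.
  have -> : M / (al / 2 ^+ j.+1) = M / al * 2 ^+ j.+1 by rewrite invf_div mulrA mulrAC.
  rewrite powRM ?exprn_ge0 // powR_exprn // exprS /z exprMn exprVn.
  by rewrite !mulrA.
(* The first summand bounds the norm of [ustar] through the level M + 1, where [phi] is below 1 even
   if M = 0; the second bounds the thresholding error at the k-th level by Q rhot^(k+1). *)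
pose Q := Num.sqrt ((M + 1) ^+ 2 * Psi (M + 1)) + Num.sqrt (M `^ p * G) * c0.
have Psi0 al : 0 <= Psi al by rewrite mulr_ge0 ?powR_ge0.
have MG0 : 0 <= M `^ p * G by rewrite mulr_ge0 ?powR_ge0.
have Q0 : 0 <= Q by rewrite addr_ge0 ?mulr_ge0 ?sqrtr_ge0 // ltW.
pose D := 2 * Q * rhot / (rhot - rho).
have D0 : 0 <= D by rewrite divr_ge0 ?mulr_ge0 // ltW.
(* r is 1 / s. Raising the k-th level to the powers -p and -2 gives powers of rhot^(k+1) c0 with
   exponents -r and -(r + 2). *)
pose r := (p^-1 - 2^-1)^-1.
have rE : r = 2 / (2 - p) * p.
  by rewrite /r; field; rewrite !gt_eqF //= subr_gt0; lra.
have rE2 : 2 / (2 - p) * 2 = r + 2.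
  by rewrite rE; field; rewrite gt_eqF.
pose B := 2 * ((2 * M) `^ p * c0 `^ (- r)) + 4 * (D ^+ 2 * c0 `^ (- (r + 2))).
have B0 : 0 <= B.
  by apply: addr_ge0; apply: mulr_ge0 => //; apply: mulr_ge0; rewrite ?powR_ge0 ?sqr_ge0.
exists (D + B + 1) => [|d H V T n_ F ustar d2 treeT enumT Flip Fu wlp normM u k].
  by rewrite ltr_pwDr // addr_ge0.
have al_gt k' : 0 < (rhot ^+ k'.+1 * c0) `^ (2 / (2 - p)).
  by rewrite powR_gt0 // mulr_gt0 // exprn_gt0.
have uphi t : sv_bound phi (n_ t) ustar.
  have [s0 sdec] := tensor_sv_props (n_ t) ustar.
  exact: weak_lp_count p0 s0 sdec (wlp t) (normM t).
have M10 : 0 < M + 1 by rewrite ltr_wpDl.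
have phi1 : phi (M + 1) < 1.
  rewrite -[ltRHS](_ : 1 `^ p = 1); last by rewrite powR1.
  rewrite /phi gt0_ltr_powR ?nnegrE ?divr_ge0 ?(ltW M10) //.
  by rewrite ltr_pdivrMr // mul1r ltrDl.
have HQ : (M + 1) ^+ 2 * Psi (M + 1) <= Q ^+ 2.
  have a0 : 0 <= (M + 1) ^+ 2 * Psi (M + 1) by rewrite mulr_ge0 ?sqr_ge0.
  rewrite -{1}(sqr_sqrtr a0) ler_sqr ?nnegrE ?sqrtr_ge0 //.
  by rewrite lerDl mulr_ge0 ?sqrtr_ge0 // ltW.
have alQ k' : (rhot ^+ k'.+1 * c0) `^ (2 / (2 - p)) ^+ 2 *
    Psi ((rhot ^+ k'.+1 * c0) `^ (2 / (2 - p))) <= (Q * (1 * rhot ^+ k'.+1)) ^+ 2.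
  set e := rhot ^+ k'.+1; have e0 : 0 < e by rewrite exprn_gt0.
  have ec : 0 < e * c0 by rewrite mulr_gt0.
  set al := (e * c0) `^ _; have al0 : 0 < al by rewrite powR_gt0.
  have -> : al ^+ 2 * Psi al = (Num.sqrt (M `^ p * G) * c0 * e) ^+ 2.
    rewrite !exprMn sqr_sqrtr // /Psi powRM ?invr_ge0 ?(ltW al0) //.
    rewrite -powR_inv1 ?(ltW al0) // -powRrM mulN1r.
    have -> : al ^+ 2 = al `^ 2 by rewrite -[X in _ `^ X]/(2%:R) powR_mulrn // ltW.
    (* The origin of the exponent 2 / (2 - p): the squared error is a multiple of al^(2 - p), which
       becomes (e c0)^2. *)
    have alE : al `^ 2 * al `^ (- p) = c0 ^+ 2 * e ^+ 2.
      rewrite -powRD; last by rewrite (gt_eqF al0) implybT.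
      rewrite -powRrM mulfVK ?gt_eqF // -[X in _ `^ X]/(2%:R) powR_mulrn ?(ltW ec) //.
      by rewrite exprMn mulrC.
    by rewrite -[RHS]mulrA -alE; ring.
  rewrite mul1r ler_sqr ?nnegrE ?mulr_ge0 ?sqrtr_ge0 ?(ltW e0) ?(ltW hc0) //.
  by rewrite ler_wpM2r ?(ltW e0) // lerDr sqrtr_ge0.
have [dist rank] := stii_rates hrho hrhot d2 treeT enumT Flip Fu phi0 uphi HPsi M10 phi1
  Q0 HQ al_gt (erefl _ : (fun=> 1) 0%N = 1) (fun=> ler01) (fun=> lexx 1) alQ k.
split.
  apply: le_trans dist _; rewrite mulr1 ler_wpM2r ?mulr_ge0 ?exprn_ge0 ?(ltW rt0) //.
  by rewrite -addrA lerDl addr_ge0.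
have K0 : 0 <= D + B + 1 by apply: addr_ge0 => //; apply: addr_ge0.
case: k rank {dist} => [|k] rank; apply: le_trans rank _; rewrite lee_fin; first by rewrite mulr_ge0 // mulr_ge0 ?powR_ge0 ?sqr_ge0.
rewrite -/D -/r mulr1; set e := rhot ^+ k.+1; have e0 : 0 < e by rewrite exprn_gt0.
have ec : 0 < e * c0 by rewrite mulr_gt0.
set al := (e * c0) `^ _; have al0 : 0 < al by rewrite powR_gt0.
have h1 : phi (al / 2) = (2 * M) `^ p * c0 `^ (- r) * e `^ (- r).
  rewrite /phi invf_div mulrA [M * 2]mulrC powRM ?mulr_ge0 ?invr_ge0 ?(ltW al0) //.
  rewrite -powR_inv1 ?(ltW al0) // -powRrM mulN1r -powRrM mulrN -rE.
  by rewrite powRM ?(ltW e0) ?(ltW hc0) //; ring.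
have h2 (D' : R) : (D' * (d%:R * e) / al) ^+ 2 = D' ^+ 2 * c0 `^ (- (r + 2)) * (d%:R ^+ 2 * e `^ (- r)).
  rewrite !exprMn exprVn.
  have -> : (al ^+ 2)^-1 = c0 `^ (- (r + 2)) * e `^ (- (r + 2)).
    have -> : al ^+ 2 = al `^ 2 by rewrite -[X in _ `^ X]/(2%:R) powR_mulrn // ltW.
    by rewrite -powRN -powRrM mulrN rE2 powRM ?(ltW e0) ?(ltW hc0) // mulrC.
  have -> : e `^ (- r) = e ^+ 2 * e `^ (- (r + 2)).
    have -> : e ^+ 2 = e `^ 2 by rewrite -[X in _ `^ X]/(2%:R) powR_mulrn // ltW.
    rewrite -powRD; last by rewrite (gt_eqF e0) implybT.
    by congr (_ `^ _); ring.
  by ring.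
rewrite h1 h2; have er : 0 <= e `^ (- r) by rewrite powR_ge0.
have dd : 1 <= d%:R ^+ 2 :> R by rewrite exprn_ege1 // ler1n (ltn_trans _ d2).
apply: (@le_trans _ _ (B * (d%:R ^+ 2 * e `^ (- r)))); last first.
  rewrite ler_wpM2r ?mulr_ge0 ?sqr_ge0 // addrAC lerDr addr_ge0 //.
rewrite /B; set X := _ `^ p * _; move: (D ^+ 2 * _) => Y.
have X0 : 0 <= X by rewrite mulr_ge0 ?powR_ge0.
have XE : 0 <= X * e `^ (- r) * (d%:R ^+ 2 - 1).
  by apply: mulr_ge0; [exact: mulr_ge0|rewrite subr_ge0].
move: (e `^ _) (d%:R ^+ 2) XE => x y XE.
by rewrite -subr_ge0 (_ : _ - _ = 2 * (X * x * (y - 1))); [lra|ring].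
Qed.

End Algebraic.

(** * Part (ii): exponentially decaying singular values *)

Section Exponential.
Context {R : realType}.
Variables (rho rhot c0 : R).
Hypotheses (hrho : 0 < rho < 1) (hrhot : rho < rhot) (hc0 : 0 < c0).

Let rho0 : 0 < rho. Proof. by case/andP: hrho. Qed.
Let rt0 : 0 < rhot. Proof. exact: lt_trans hrhot. Qed.
Let rr0 : 0 < rhot - rho. Proof. by rewrite subr_gt0. Qed.

Definition exponential_bound (C c beta K : R) : Prop :=
  forall (d : nat) (H : 'I_d -> hilbert R) (V : tensor_space H)
    (T : {set {set 'I_d}}) (n_ : 'I_(2 * d - 3) -> {set 'I_d})
    (F : V [set: 'I_d]%SET -> V [set: 'I_d]%SET) (ustar : V [set: 'I_d]%SET),
  (2 <= d)%N -> dimension_tree T -> edge_enumeration T n_ ->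
  (forall v w, `|F v - F w| <= rho * `|v - w|) -> F ustar = ustar ->
  (forall t k, tensor_sv (n_ t) ustar k <= C * expR (- c * k.+1%:R `^ beta)) ->
  let u := stii n_ F (fun k => rhot ^+ k.+1 * c0) in
  forall k, `|u k - ustar| <=
      K * (d%:R * (1 + `|ln (rhot ^+ k)|) `^ (2 * beta)^-1 * rhot ^+ k) /\
    (\big[maxe/0]_(t < 2 * d - 3) tensor_rank (n_ t) (u k)
       <= (K * (d%:R ^+ 2 * (1 + `|ln (rhot ^+ k)|) `^ beta^-1))%:E)%E.

Lemma exponential_rates (C c beta : R) : 0 < C -> 0 < c -> 0 < beta ->
  exists2 K, 0 < K & exponential_bound C c beta K.
Proof.
move=> C0 c0' b0.
pose g := beta^-1; have g0 : 0 < g by rewrite invr_gt0.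
have [K2 K20 HK2] := powR_le_exp2 g0.
pose phi (y : R) := (Num.max 0 (ln (C / y)) / c) `^ g.
(* Being at least 1, this quantity dominates the logarithm after j + 1 halvings of the level up to
   the factor j + 1, which separates al from j. *)
pose LL (y : R) := 1 + Num.max 0 (ln (C / y)).
have LL1 y : 1 <= LL y by rewrite lerDl le_max lexx.
have LL0 y : 0 <= LL y by rewrite (le_trans ler01).
(* [K2] absorbs (j + 1)^g into 2^j; against the weights 4^-j this leaves a geometric series with sum
   2. *)
pose Psi (y : R) := (LL y / c) `^ g * (K2 * 2).
have ln2 : ln 2 <= 1 :> R.
  by have /le_ln1Dx : -1 < 1 :> R by rewrite (lt_trans (ltrN10 R)) ?ltr01.
have ln20 : 0 <= ln 2 :> R by rewrite ln_ge0 // ler1n.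
have phi0 y : 0 < y -> 0 <= phi y by rewrite powR_ge0.
have phi_half al j : 0 < al -> phi (al / 2 ^+ j.+1) <= (LL al / c) `^ g * j.+1%:R `^ g.
  move=> al0; rewrite -powRM ?divr_ge0 ?(ltW c0') // /phi.
  apply: ge0_ler_powR; rewrite ?nnegrE ?(ltW g0) //.
  - by rewrite divr_ge0 ?(ltW c0') // le_max lexx.
  - by rewrite mulr_ge0 // divr_ge0 // ltW.
  rewrite mulrAC ler_pM2r ?invr_gt0 // ge_max mulr_ge0 //=.
  have -> : C / (al / 2 ^+ j.+1) = C / al * 2 ^+ j.+1 by rewrite invf_div mulrA mulrAC.
  rewrite lnM ?posrE ?divr_gt0 ?exprn_gt0 // lnXn // -[ln 2 *+ _]mulr_natl.
  have j1 : 1 <= j.+1%:R :> R by rewrite ler1n.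
  have m0 : ln (C / al) <= Num.max 0 (ln (C / al)) by rewrite le_max lexx orbT.
  have m1 : 0 <= Num.max 0 (ln (C / al)) by rewrite le_max lexx.
  rewrite /LL; move: m0 m1; move: (Num.max 0 (ln (C / al))) => m; move: (ln (C / al)) => l m0 m1.
  move: (j.+1%:R) j1 => J J1; move: (ln 2) ln2 ln20 => L h1 h2; nra.
have HPsi al m : 0 < al -> \sum_(0 <= j < m) phi (al / 2 ^+ j.+1) / 4 ^+ j <= Psi al.
  move=> al0; have La : 0 <= (LL al / c) `^ g by rewrite powR_ge0.
  apply: (@le_trans _ _ (\sum_(0 <= j < m) (LL al / c) `^ g * K2 * (2^-1) ^+ j)).
    apply: ler_sum => j _.
    apply: (@le_trans _ _ ((LL al / c) `^ g * (K2 * 2 ^+ j) / 4 ^+ j)).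
      rewrite ler_pM2r ?invr_gt0 ?exprn_gt0 // (le_trans (phi_half _ _ al0)) //.
      by rewrite ler_wpM2l.
    have -> : 4 = 2 * 2 :> R by rewrite -natrM.
    rewrite exprMn exprVn; set q := 2 ^+ j; have q0 : q != 0 by rewrite expf_neq0 // pnatr_eq0.
    by rewrite le_eqVlt; apply/orP; left; apply/eqP; field.
  rewrite -mulr_sumr /Psi mulrA ler_wpM2l ?mulr_ge0 ?(ltW K20) //.
  apply: le_trans (geometric_bound _ _) _.
    by rewrite invr_ge0 ler0n /= invf_lt1 // ltr1n.
  by rewrite (_ : 1 - 2^-1 = 2^-1) ?invrK //; field.
have Psi0 y : 0 <= Psi y by rewrite !mulr_ge0 ?powR_ge0 ?(ltW K20).
(* Absorbs c0: [LL] at the level rhot^k c0 is at most [kap] times 1 + |ln rhot^k|. *)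
pose kap := 1 + `|ln (C / c0)|.
have kap0 : 0 <= kap by rewrite addr_ge0.
pose P := (kap / c) `^ g.
have P0 : 0 <= P by rewrite powR_ge0.
pose Q := Num.sqrt (C ^+ 2 * Psi C) + Num.sqrt (P * (K2 * 2)) * c0.
have PK0 : 0 <= P * (K2 * 2) by rewrite !mulr_ge0 // ltW.
have Q0 : 0 <= Q by rewrite addr_ge0 ?mulr_ge0 ?sqrtr_ge0 // ltW.
pose D := 2 * Q * rhot / (rhot - rho).
have D0 : 0 <= D by rewrite divr_ge0 ?mulr_ge0 // ltW.
pose B := 2 * P + 4 * (D / c0) ^+ 2.
have B0 : 0 <= B by apply: addr_ge0; apply: mulr_ge0; rewrite ?sqr_ge0.
pose L k := 1 + `|ln (rhot ^+ k)|.
have L0 k : 0 <= L k by rewrite addr_ge0.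
(* Half the exponent 1 / beta, because it is the squared error that carries the factor [Psi]. *)
pose Lam k := L k `^ (2 * beta)^-1.
have Lam2 k : Lam k ^+ 2 = L k `^ g.
  have -> : Lam k ^+ 2 = Lam k `^ 2 by rewrite -[X in _ `^ X]/(2%:R) powR_mulrn // powR_ge0.
  by rewrite -powRrM invfM mulrAC mulVf ?mul1r ?pnatr_eq0.
have LLe k : LL (rhot ^+ k * c0) / c <= kap / c * L k.
  rewrite mulrAC ler_pM2r ?invr_gt0 // /LL /kap /L.
  have -> : C / (rhot ^+ k * c0) = C / c0 / rhot ^+ k by rewrite invfM mulrCA mulrC.
  rewrite ln_div ?posrE ?divr_gt0 ?exprn_gt0 //.
  move: (ln (C / c0)) (ln (rhot ^+ k)) => a b.
  have ha := ler_norm a; have hb := ler_norm (- b); rewrite normrN in hb.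
  have na := normr_ge0 a; have nb := normr_ge0 b.
  have : Num.max 0 (a - b) <= `|a| + `|b|.
    by rewrite ge_max addr_ge0 //= lerD.
  by have := mulr_ge0 na nb; move: `|a| `|b| (Num.max _ _) => x y m; nra.
have LLg k : (LL (rhot ^+ k * c0) / c) `^ g <= P * L k `^ g.
  rewrite /P -powRM ?divr_ge0 ?(ltW c0') //.
  by apply: ge0_ler_powR; rewrite ?nnegrE ?(ltW g0) ?mulr_ge0 ?invr_ge0 ?(ltW c0').
exists (D + B + 1) => [|d H V T n_ F ustar d2 treeT enumT Flip Fu svb u k].
  by rewrite ltr_pwDr // addr_ge0.
have al_gt k' : 0 < rhot ^+ k'.+1 * c0 by rewrite mulr_gt0 // exprn_gt0.
have uphi t : sv_bound phi (n_ t) ustar by exact: exp_count C0 c0' b0 (svb t).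
(* At the level C the truncated logarithm is 0, so C serves as the level that sends [ustar] to 0. *)
have phi1 : phi C < 1.
  by rewrite /phi divff ?gt_eqF // ln1 maxxx mul0r powR0 ?ltr01 // gt_eqF.
have HQ : C ^+ 2 * Psi C <= Q ^+ 2.
  have a0 : 0 <= C ^+ 2 * Psi C by rewrite mulr_ge0 ?sqr_ge0.
  rewrite -{1}(sqr_sqrtr a0) ler_sqr ?nnegrE ?sqrtr_ge0 //.
  by rewrite lerDl mulr_ge0 ?sqrtr_ge0 // ltW.
have Lamge k' : 0 <= Lam k' by rewrite powR_ge0.
have Lam0 : Lam 0%N = 1 by rewrite /Lam /L expr0 ln1 normr0 addr0 powR1.
have LamS k' : Lam k' <= Lam k'.+1.
  apply: ge0_ler_powR; rewrite ?nnegrE ?L0 //.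
    by rewrite invr_ge0 mulr_ge0 // ltW.
  (* |ln rhot^k| = k |ln rhot| is non-decreasing in k, whether rhot is below or above 1. *)
  rewrite /L lerD2l !lnXn // !normrMn mulrSr.
  by rewrite lerDl.
have alQ k' : (rhot ^+ k'.+1 * c0) ^+ 2 * Psi (rhot ^+ k'.+1 * c0) <=
    (Q * (Lam k'.+1 * rhot ^+ k'.+1)) ^+ 2.
  have e0 : 0 < rhot ^+ k'.+1 by rewrite exprn_gt0.
  apply: (@le_trans _ _ ((Num.sqrt (P * (K2 * 2)) * c0 * (Lam k'.+1 * rhot ^+ k'.+1)) ^+ 2)).
    rewrite [leRHS]exprMn [(Num.sqrt _ * _) ^+ 2]exprMn sqr_sqrtr // [(Lam _ * _) ^+ 2]exprMn Lam2.
    rewrite /Psi.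
    apply: (@le_trans _ _ ((rhot ^+ k'.+1 * c0) ^+ 2 * (P * L k'.+1 `^ g * (K2 * 2)))).
      by rewrite ler_wpM2l ?sqr_ge0 // ler_wpM2r ?LLg // mulr_ge0 // ltW.
    by rewrite le_eqVlt; apply/orP; left; apply/eqP; ring.
  rewrite ler_sqr ?nnegrE ?mulr_ge0 ?sqrtr_ge0 ?(ltW e0) ?(ltW hc0) //.
  by rewrite ler_wpM2r ?mulr_ge0 ?(ltW e0) // lerDr sqrtr_ge0.
have [dist rank] := stii_rates hrho hrhot d2 treeT enumT Flip Fu phi0 uphi HPsi C0 phi1
  Q0 HQ al_gt Lam0 Lamge LamS alQ k.
split.
  apply: le_trans dist _; rewrite ler_wpM2r ?mulr_ge0 ?exprn_ge0 ?(ltW rt0) //.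
  by rewrite -addrA lerDl addr_ge0.
have K0 : 0 <= D + B + 1 by apply: addr_ge0 => //; apply: addr_ge0.
case: k rank {dist} => [|k] rank; apply: le_trans rank _; rewrite lee_fin.
  by rewrite mulr_ge0 // mulr_ge0 ?powR_ge0 ?sqr_ge0.
rewrite -/D -/g -/(L k.+1); set e := rhot ^+ k.+1; have e0 : 0 < e by rewrite exprn_gt0.
have h1 : phi (e * c0 / 2) <= P * L k.+1 `^ g.
  apply: le_trans (LLg k.+1).
  have := phi_half (e * c0) 0%N (al_gt k); rewrite expr1 => /le_trans; apply.
  by rewrite powR1 mulr1.
have h2 (D' : R) : (D' * (d%:R * Lam k.+1 * e) / (e * c0)) ^+ 2 =
    (D' / c0) ^+ 2 * (d%:R ^+ 2 * L k.+1 `^ g).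
  by rewrite -Lam2; field; rewrite !gt_eqF.
rewrite h2; have er : 0 <= L k.+1 `^ g by rewrite powR_ge0.
have dd : 1 <= d%:R ^+ 2 :> R by rewrite exprn_ege1 // ler1n (ltn_trans _ d2).
apply: (@le_trans _ _ (B * (d%:R ^+ 2 * L k.+1 `^ g))); last first.
  by rewrite ler_wpM2r ?mulr_ge0 ?sqr_ge0 // addrAC lerDr addr_ge0.
have XE : 0 <= P * L k.+1 `^ g * (d%:R ^+ 2 - 1).
  by apply: mulr_ge0; [exact: mulr_ge0|rewrite subr_ge0].
rewrite /B; move: (phi _) (L k.+1 `^ g) (d%:R ^+ 2) ((D / c0) ^+ 2) h1 XE => f x y Y h1 XE.
have -> : (2 * P + 4 * Y) * (y * x) = 2 * (P * x) + 4 * (Y * (y * x)) + 2 * (P * x * (y - 1)).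
  by ring.
lra.
Qed.

End Exponential.

(* K1 and K2 give the constants hidden in the two parts: they depend on neither
   k nor t, nor on d, the spaces, the tree or F. *)
Theorem theorem4p4 (R : realType) (rho rhot c0 : R)
    (hrho : 0 < rho < 1) (hrhot : rho < rhot) (hc0 : 0 < c0) :
  exists (K1 : R -> R -> R) (K2 : R -> R -> R -> R),
    (forall p M, 0 < K1 p M) /\ (forall C c beta, 0 < K2 C c beta) /\
    forall (d : nat) (H : 'I_d -> hilbert R) (V : tensor_space H)
      (T : {set {set 'I_d}}) (n_ : 'I_(2 * d - 3) -> {set 'I_d})
      (F : V [set: 'I_d]%SET -> V [set: 'I_d]%SET)
      (ustar : V [set: 'I_d]%SET),
    (2 <= d)%N ->
    (forall i, separable (H i)) ->
    dimension_tree T ->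
    edge_enumeration T n_ ->
    (forall v w, `|F v - F w| <= rho * `|v - w|) ->
    F ustar = ustar ->
    let eps k := rhot ^+ k in
    (forall p : R, 0 < p < 2 ->
       (forall t, weak_lp p (tensor_sv (n_ t) ustar)) ->
       let u := stii n_ F (fun k => (rhot ^+ k.+1 * c0) `^ (2 / (2 - p))) in
       let s := p^-1 - 2^-1 in
       let M := \big[Num.max/0]_(t < 2 * d - 3)
                  fine (weak_lp_norm p (tensor_sv (n_ t) ustar)) in
       forall k,
         `|u k - ustar| <= K1 p M * (d%:R * eps k) /\
         (\big[maxe/0]_(t < 2 * d - 3) tensor_rank (n_ t) (u k)
            <= (K1 p M * (d%:R ^+ 2 * eps k `^ (- s^-1)))%:E)%E)
    /\
    (forall C c beta : R, 0 < C -> 0 < c -> 0 < beta ->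
       (forall t k, tensor_sv (n_ t) ustar k
                      <= C * expR (- c * k.+1%:R `^ beta)) ->
       let u := stii n_ F (fun k => rhot ^+ k.+1 * c0) in
       forall k,
         `|u k - ustar| <=
           K2 C c beta * (d%:R * (1 + `|ln (eps k)|) `^ (2 * beta)^-1 * eps k) /\
         (\big[maxe/0]_(t < 2 * d - 3) tensor_rank (n_ t) (u k)
            <= (K2 C c beta * (d%:R ^+ 2 * (1 + `|ln (eps k)|) `^ beta^-1))%:E)%E).
Proof.
(* The constants are functions on all parameters; inadmissible ones receive the value 1, which keeps
   positivity unconditional. *)
have /choice[K1 HK1] (q : R * R) : exists K, 0 < K /\
    (0 < q.1 < 2 -> 0 <= q.2 -> algebraic_bound rho rhot c0 q.1 q.2 K).
  have [[hp hM]|h] := pselect (0 < q.1 < 2 /\ 0 <= q.2).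
    by have [K K0 HK] := algebraic_rates hrho hrhot hc0 hp hM; exists K.
  by exists 1; split=> // hp hM; case: h.
have /choice[K2 HK2] (q : R * R * R) : exists K, 0 < K /\
    (0 < q.1.1 -> 0 < q.1.2 -> 0 < q.2 ->
      exponential_bound rho rhot c0 q.1.1 q.1.2 q.2 K).
  have [[hC hc hb]|h] := pselect [/\ 0 < q.1.1, 0 < q.1.2 & 0 < q.2].
    by have [K K0 HK] := exponential_rates hrho hrhot hc0 hC hc hb; exists K.
  by exists 1; split=> // hC hc hb; case: h.
exists (fun p M => K1 (p, M)), (fun C c beta => K2 (C, c, beta)).
split; first by move=> p M; exact: (HK1 (p, M)).1.
split; first by move=> C c beta; exact: (HK2 (C, c, beta)).1.
move=> d H V T n_ F ustar d2 _ treeT enumT Flip Fu eps; split.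
  move=> p hp wlp u s M.
  have M0 : 0 <= M by exact: bigmax_ge_id.
  apply: ((HK1 (p, M)).2 hp M0 d H V T) => // t; exact: le_bigmax.
move=> C c beta hC hc hb svb u.
exact: ((HK2 (C, c, beta)).2 hC hc hb d H V T).
Qed.
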